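(* Let \[\rho^*:= \mathtt{123}+\mathtt{321} + \mathtt{2143}+\mathtt{3412}+ \frac{1}{2}\left(\mathtt{2413} + \mathtt{3142}\right).\] For every permuton $\mu$, $d(\rho^*,\mu)\ge 11/24$. Moreover, $d(\rho^*,\mu)=11/24$ if and only if $\mu$ is the uniform measure on $[0,1]^2$.
   Context: A permuton is a Borel probability measure $\mu$ on $[0,1]^2$ with uniform marginals: $\mu(X\times[0,1])=\mu([0,1]\times X)=\lambda(X)$ for every Borel $X\subseteq[0,1]$, where $\lambda$ is Lebesgue measure. For a permutation $\pi$ of order $n$ (a bijection of $[n]$, written as the word $\pi(1)\cdots\pi(n)$), the density $d(\pi,\mu)$ is the probability that $n$ points $(x_1,y_1),\dots,(x_n,y_n)$ sampled independently from $\mu$ and indexed so that $x_1<\dots<x_n$ satisfy $y_i<y_j \iff \pi(i)<\pi(j)$ for all $i,j$. Density is extended linearly to linear combinations of permutations: $d(\sum_i c_i\pi_i,\mu)=\sum_i c_i d(\pi_i,\mu)$. *)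

(* Defs.v *)
From HB Require Import structures.
From mathcomp Require Import all_boot all_order all_algebra all_fingroup.
From mathcomp Require Import all_classical all_reals all_analysis.
From mathcomp Require Import measurable_realfun.

Set Implicit Arguments.
Unset Strict Implicit.
Unset Printing Implicit Defensive.

Import Order.TTheory GRing.Theory Num.Theory.

Local Open Scope classical_set_scope.
Local Open Scope ring_scope.

Section power_measure.
Context {d : measure_display} {T : measurableType d} {R : realType}.

Definition tuple_cons n (p : T * n.-tuple T) : n.+1.-tuple T :=
  [tuple of p.1 :: p.2].

Lemma measurable_tuple_cons n : measurable_fun setT (@tuple_cons n).
Proof. by apply: measurable_cons. Qed.

HB.instance Definition _ n :=
  isMeasurableFun.Build _ _ _ _ (@tuple_cons n) (@measurable_tuple_cons n).

(* The joint law, on [n.-tuple T], of n independent samples of P: the n-fold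
   product measure, transported along [T * n.-tuple T -> n.+1.-tuple T]. *)
Fixpoint power_measure (P : probability T R) n : probability (n.-tuple T) R :=
  match n with
  | 0 => \d_([tuple] : 0.-tuple T)
  | m.+1 => distribution (P \x power_measure P m)%E (@tuple_cons m)
  end.

Lemma power_measure_box (P : probability T R) n (A : 'I_n -> set T) :
  (forall i, measurable (A i)) ->
  power_measure P n [set t | forall i, A i (tnth t i)] = (\prod_i P (A i))%E.
Proof.
elim: n A => [|n IH] A mA.
  by rewrite big_ord0 /= diracE mem_set//= => -[].
rewrite big_ord_recl -IH//= /distribution /pushforward.
have mB : measurable [set t : n.-tuple T | forall i, A (lift ord0 i) (tnth t i)].
  rewrite (_ : [set _ | _] =
      \big[setI/setT]_(i < n) ((@tnth n T ^~ i) @^-1` (A (lift ord0 i)))).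
    apply: bigsetI_measurable => i _; rewrite -[X in measurable X]setTI.
    exact: measurable_tnth.
  rewrite -bigcap_seq; apply/seteqP; split => t /= At i.
    by move=> _; exact: At.
  by apply: (At i) => /=; rewrite mem_index_enum.
rewrite -product_measure1E//; congr (product_measure1 _ _ _).
apply/seteqP; split => -[x t] /=.
  move=> At; split; first exact: (At ord0).
  by move=> i; have := At (lift ord0 i); rewrite tnthS.
move=> [Ax At] i; have [->//|/eqP i0] := eqVneq i ord0.
by case: (unliftP ord0 i) i0 => [j ->|->//] _; rewrite tnthS; exact: At.
Qed.

End power_measure.

Section permuton.
Context {R : realType}.

(* Measures on [0,1]^2 are represented as measures on R^2 carried by
   [0,1]^2; the product sigma-algebra on R^2 is the Borel one.  The case
   X = [0,1] gives mu ([0,1]^2) = 1. *)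
Definition plane := (measurableTypeR R * measurableTypeR R)%type.

Definition unit_itv : set (measurableTypeR R) := `[0, 1]%classic.

Definition is_permuton (mu : probability plane R) : Prop :=
  forall X : set (measurableTypeR R), measurable X -> X `<=` unit_itv ->
    mu (X `*` unit_itv) = lebesgue_measure X /\
    mu (unit_itv `*` X) = lebesgue_measure X.

Definition is_uniform (mu : probability plane R) : Prop :=
  forall A : set plane, measurable A ->
    mu A = (lebesgue_measure \x lebesgue_measure)%E
             (A `&` (unit_itv `*` unit_itv)).

Definition xcoord (p : plane) : R := p.1.
Definition ycoord (p : plane) : R := p.2.

(* s is the relabelling of the samples that lists them by increasing x. *)
Definition pattern_event n (pi : 'S_n) : set (n.-tuple plane) :=
  [set t | exists s : 'S_n,
     (forall i j : 'I_n, (i < j)%N ->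
        xcoord (tnth t (s i)) < xcoord (tnth t (s j))) /\
     (forall i j : 'I_n,
        ycoord (tnth t (s i)) < ycoord (tnth t (s j)) <-> (pi i < pi j)%N)].

Lemma measurable_pattern_event n (pi : 'S_n) : measurable (pattern_event pi).
Proof.
have mx (i : 'I_n) :
    measurable_fun setT (fun t : n.-tuple plane => xcoord (tnth t i)).
  apply: (measurableT_comp (f := fst : plane -> measurableTypeR R)) => //.
  exact: measurable_tnth.
have my (i : 'I_n) :
    measurable_fun setT (fun t : n.-tuple plane => ycoord (tnth t i)).
  apply: (measurableT_comp (f := snd : plane -> measurableTypeR R)) => //.
  exact: measurable_tnth.
have mlt (f g : n.-tuple plane -> R) : measurable_fun setT f ->
    measurable_fun setT g -> measurable [set t | f t < g t].
  move=> mf mg; rewrite -[X in measurable X]setTI.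
  exact: (measurable_fun_ltr mf mg measurableT (Y := [set true])).
rewrite (_ : pattern_event pi = \bigcup_(s in [set: 'S_n])
   ((\bigcap_(p in [set p : 'I_n * 'I_n | (p.1 < p.2)%N])
      [set t | xcoord (tnth t (s p.1)) < xcoord (tnth t (s p.2))]) `&`
    (\bigcap_(p in [set: 'I_n * 'I_n])
      [set t | ycoord (tnth t (s p.1)) < ycoord (tnth t (s p.2)) <->
               (pi p.1 < pi p.2)%N]))); last first.
  apply/seteqP; split => t /= [s].
    by move=> [xs ys]; exists s => //; split => [[i j] /= /xs|[i j] _ /=].
  move=> _ [xs ys]; exists s; split => [i j ij|i j].
    exact: (xs (i, j)).
  exact: (ys (i, j)).
apply: fin_bigcup_measurable => [|s _]; first exact: finite_finset.
apply: measurableI.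
  apply: fin_bigcap_measurable => [|p _]; first exact: finite_finset.
  exact: mlt.
apply: fin_bigcap_measurable => [|p _]; first exact: finite_finset.
case: (pi p.1 < pi p.2)%N.
  rewrite (_ : [set _ | _] =
    [set t | ycoord (tnth t (s p.1)) < ycoord (tnth t (s p.2))]); first exact: mlt.
  by apply/seteqP; split => t /= => [[_]|ylt]; [exact|split].
rewrite (_ : [set _ | _] =
  ~` [set t | ycoord (tnth t (s p.1)) < ycoord (tnth t (s p.2))]).
  by apply: measurableC; exact: mlt.
by apply/seteqP; split => t /= => [[/[swap] _ ylt] /ylt|ynlt]; [|split].
Qed.

Definition density n (pi : 'S_n) (mu : probability plane R) : R :=
  fine (power_measure mu n (pattern_event pi)).

(* A formal linear combination of permutations, as a list of terms. *)
Definition lin_comb := seq (R * {n : nat & 'S_n}).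

Definition lin_density (rho : lin_comb) (mu : probability plane R) : R :=
  \sum_(term <- rho) term.1 * density (tagged term.2) mu.

End permuton.
Arguments plane R : clear implicits.
Arguments lin_comb R : clear implicits.

Section word.
Variables (n : nat) (w : seq nat).
Hypothesis w_perm : perm_eq w (iota 1 n).

(* insubd's default value is never used, see perm_of_wordE. *)
Definition word_fun (i : 'I_n) : 'I_n := insubd i (nth 0%N w i).-1.

Let size_w : size w = n.
Proof. by rewrite (perm_size w_perm) size_iota. Qed.

Lemma word_funE i : (word_fun i).+1 = nth 0%N w i.
Proof.
have : nth 0%N w i \in w by rewrite mem_nth// size_w.
rewrite (perm_mem w_perm) mem_iota => /andP[w_gt0 w_le].
have w_lt : ((nth 0%N w i).-1 < n)%N by rewrite prednK// -ltnS -add1n.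
by rewrite /word_fun val_insubd w_lt prednK.
Qed.

Lemma word_fun_inj : injective word_fun.
Proof.
move=> i j eq_ij; apply/val_inj/eqP.
have uniq_w : uniq w by rewrite (perm_uniq w_perm) iota_uniq.
have /eqP : nth 0%N w i = nth 0%N w j by rewrite -!word_funE eq_ij.
by rewrite nth_uniq ?size_w.
Qed.

Definition perm_of_word : 'S_n := perm word_fun_inj.

Lemma perm_of_wordE i : (perm_of_word i).+1 = nth 0%N w i.
Proof. by rewrite permE word_funE. Qed.

End word.

Definition term (R : realType) (c : R) (w : seq nat)
    (w_perm : perm_eq w (iota 1 (size w))) : R * {n : nat & 'S_n} :=
  (c, Tagged (fun n => 'S_n) (perm_of_word w_perm)).

Definition rho_star (R : realType) : lin_comb R :=
  [:: @term R 1 [:: 1; 2; 3]%N isT;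
      @term R 1 [:: 3; 2; 1]%N isT;
      @term R 1 [:: 2; 1; 4; 3]%N isT;
      @term R 1 [:: 3; 4; 1; 2]%N isT;
      @term R (1 / 2) [:: 2; 4; 1; 3]%N isT;
      @term R (1 / 2) [:: 3; 1; 4; 2]%N isT].

(* Main.v *)
Require Import Defs.
From HB Require Import structures.
From mathcomp Require Import all_boot all_order all_algebra all_fingroup.
From mathcomp Require Import all_classical all_reals all_analysis.
From mathcomp Require Import measurable_realfun ring lra.
Import Order.TTheory GRing.Theory Num.Theory.
Import numFieldNormedType.Exports.
Set Implicit Arguments.
Unset Strict Implicit.
Unset Printing Implicit Defensive.
Local Open Scope classical_set_scope.
Local Open Scope ring_scope.

(** Let [K p q], equal to 1 or -1, record whether the sample points [p] and [q]
    are concordant.  The density of [rho_star] only depends on the inversion graph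
    of the sample, hence is the mean of a polynomial in the [K p q]; in it the
    terms [E (K p q * K p r)] cancel and
      [d rho_star mu = 7/16 + 3/8 (E K)^2 + 3/16 E (K2 p q ^2)],
    where [K2 p q = E_r (K p r * K r q)].  So it suffices to bound
    [E (K2 p q ^2)] from below by [1/9].

    Let [psi a b = sg (a - b) / 2 - (a - b)], which has mean zero in each
    variable under the uniform law, and let [D a b = E_r (psi a x_r * psi b y_r)]:
    this is [mu ([0,a] * [0,b]) - a b], recentred in each variable.  If [mu] is
    uniform, then [K2] is [h p q = (1 - 2 |x_p - x_q|) (1 - 2 |y_p - y_q|)], which
    suggests expanding [0 <= E ((K2 - h) ^2)].  All terms can be computed thanks to
      [sg (a - r) * sg (r - b) * sg (a - b) = 2 (psi a r + psi r b - psi a b)],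
    and the result is
      [E (K2 p q ^2) >= 1/9 + 96 E (D x_p y_q ^2) + 32 E (D x_p y_p ^2)].
    In case of equality the continuous function [D] vanishes on [0,1]^2, and its
    second differences give [mu ([0,a] * [0,b]) = a b]. *)

(** * Bounded measurable functions *)

Section bounded_measurable.
Context {d : measure_display} {X : measurableType d} {R : realType}.
Implicit Types f g : X -> R.

(** The class of integrands used throughout: membership settles integrability and the use of
    Fubini's theorem at once. *)
Definition bmeas f :=
  measurable_fun setT f /\ exists M : R, forall x, `|f x| <= M.

Lemma bmeas_cst c : bmeas (fun=> c).
Proof. by split; [exact: measurable_cst|exists `|c|]. Qed.

Lemma bmeasD f g : bmeas f -> bmeas g -> bmeas (fun x => f x + g x).
Proof.
move=> [mf [M fM]] [mg [N gN]]; split; first exact: measurable_funD.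
by exists (M + N) => x; apply: (le_trans (ler_normD _ _)); apply: lerD.
Qed.

Lemma bmeasN f : bmeas f -> bmeas (fun x => - f x).
Proof.
move=> [mf [M fM]]; split; first exact: measurable_funN.
by exists M => x; rewrite normrN.
Qed.

Lemma bmeasM f g : bmeas f -> bmeas g -> bmeas (fun x => f x * g x).
Proof.
move=> [mf [M fM]] [mg [N gN]]; split; first exact: measurable_funM.
by exists (M * N) => x; rewrite normrM ler_pM.
Qed.

Lemma bmeasX f n : bmeas f -> bmeas (fun x => f x ^+ n).
Proof.
move=> bf; elim: n => [|n IHn]; first exact: bmeas_cst.
by under eq_fun do rewrite exprS; exact: bmeasM.
Qed.

Lemma bmeas_ind (A : set X) : measurable A -> bmeas (\1_A : X -> R).
Proof.
move=> mA; split; first exact/measurable_indicP.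
by exists 1 => x; rewrite indicE; case: (x \in A); rewrite ?normr1 ?normr0.
Qed.

Lemma sgrE (x : R) : Num.sg x = (0 < x)%R%:R - (x < 0)%R%:R.
Proof. by case: sgrP => _; rewrite ?subrr ?subr0 ?sub0r. Qed.

Lemma measurable_fun_natb (b : X -> bool) :
  measurable_fun setT b -> measurable_fun setT (fun x => (b x)%:R : R).
Proof.
move=> mb; apply: (measurableT_comp (f := fun c : bool => c%:R : R)) => //.
Qed.

Lemma measurable_bmeas_sg f :
  measurable_fun setT f -> bmeas (fun x => Num.sg (f x)).
Proof.
move=> mf; split; last by exists 1 => x; rewrite normr_sg; case: (_ != _).
under eq_fun do rewrite sgrE.
by apply: measurable_funB; apply: measurable_fun_natb; apply: measurable_fun_ltr.
Qed.

Lemma bmeas_sg f : bmeas f -> bmeas (fun x => Num.sg (f x)).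
Proof. by move=> [mf _]; exact: measurable_bmeas_sg. Qed.

End bounded_measurable.

Lemma bmeas_comp {d d' : measure_display} {X : measurableType d}
    {Z : measurableType d'} {R : realType} (f : X -> R) (g : Z -> X) :
  bmeas f -> measurable_fun setT g -> bmeas (fun z => f (g z)).
Proof.
move=> [mf [M fM]] mg; split; first exact: (measurableT_comp mf mg).
by exists M.
Qed.

(** * Real-valued expectations *)

Section expectation.
Context {d : measure_display} {T : measurableType d} {R : realType}.
Variable P : probability T R.
Implicit Types f g : T -> R.

Definition ex f : R := \int[P]_x f x.

Lemma bmeas_integrable f : bmeas f -> P.-integrable setT (EFin \o f).
Proof.
move=> [mf [M fM]]; apply: measurable_bounded_integrable => //.
  by rewrite ltey_eq fin_num_measure.
exists M; split; first by rewrite num_real.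
by move=> x Mx t _; exact: le_trans (fM t) (ltW Mx).
Qed.

Lemma EFin_ex f : bmeas f -> (ex f)%:E = (\int[P]_x (f x)%:E)%E.
Proof.
move=> bf; rewrite /ex /Rintegral fineK//.
exact: (integrable_fin_num _ (bmeas_integrable bf)).
Qed.

Lemma eq_ex f g : f =1 g -> ex f = ex g.
Proof. by move=> fg; apply: eq_Rintegral => x _; exact: fg. Qed.

Lemma ex_cst c : ex (fun=> c) = c.
Proof. by rewrite /ex Rintegral_cst//= probability_setT mulr1. Qed.

Lemma exD f g : bmeas f -> bmeas g -> ex (fun x => f x + g x) = ex f + ex g.
Proof. by move=> bf bg; rewrite /ex RintegralD//; exact: bmeas_integrable. Qed.

Lemma exZl c f : bmeas f -> ex (fun x => c * f x) = c * ex f.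
Proof. by move=> bf; rewrite /ex RintegralZl//; exact: bmeas_integrable. Qed.

Lemma exZr c f : bmeas f -> ex (fun x => f x * c) = ex f * c.
Proof. by move=> bf; rewrite /ex RintegralZr//; exact: bmeas_integrable. Qed.

Lemma exN f : bmeas f -> ex (fun x => - f x) = - ex f.
Proof.
by move=> bf; rewrite -mulN1r -exZl//; apply: eq_ex => x; rewrite mulN1r.
Qed.

Lemma exB f g : bmeas f -> bmeas g -> ex (fun x => f x - g x) = ex f - ex g.
Proof. by move=> bf bg; rewrite /ex RintegralB//; exact: bmeas_integrable. Qed.

Lemma ex_ge0 f : (forall x, 0 <= f x) -> 0 <= ex f.
Proof. by move=> f0; apply: Rintegral_ge0 => x _; exact: f0. Qed.

Lemma le_ex f g : bmeas f -> bmeas g -> (forall x, f x <= g x) -> ex f <= ex g.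
Proof.
by move=> bf bg fg; apply: le_Rintegral => //; exact: bmeas_integrable.
Qed.

Lemma norm_ex_le f g : bmeas f -> bmeas g ->
  (forall x, `|f x| <= g x) -> `|ex f| <= ex g.
Proof.
move=> bf bg fg; rewrite ler_norml -exN//; apply/andP; split.
  apply: le_ex => [||x]; [exact: bmeasN|by []|].
  by have := fg x; rewrite ler_norml => /andP[].
by apply: le_ex => // x; have := fg x; rewrite ler_norml => /andP[].
Qed.

Lemma ex_indic (A : set T) : measurable A -> ex (\1_A) = fine (P A).
Proof. by move=> mA; rewrite /ex /Rintegral integral_indic// setIT. Qed.

Lemma eq_ex_null (A : set T) f g : measurable A -> P A = 0%E ->
  bmeas f -> bmeas g -> (forall x, ~ A x -> f x = g x) -> ex f = ex g.
Proof.
move=> mA PA bf bg fg; rewrite /ex /Rintegral; congr fine.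
apply: ae_eq_integral => //.
- by apply/measurable_EFinP; case: bf.
- by apply/measurable_EFinP; case: bg.
exists A; split => // x /=; apply: contra_notP => nAx _.
by rewrite fg.
Qed.

End expectation.

(** * Iterated expectations and Fubini's theorem *)

Section iterated.
Context {d d' : measure_display} {X : measurableType d}
  {T : measurableType d'} {R : realType}.
Variable P : probability T R.

Lemma bmeas_ex (f : X -> T -> R) :
  bmeas (fun w : X * T => f w.1 w.2) -> bmeas (fun x => ex P (f x)).
Proof.
move=> [mf [M fM]].
have bfx x : bmeas (f x).
  split; last by exists M => t; exact: (fM (x, t)).
  exact: (measurableT_comp mf (pair1_measurable x)).
(* Tonelli's measurability statement is for nonnegative functions, hence the shift by the bound [M],
   undone at the end. *)
have fM0 x t : 0 <= f x t + M.
  by have := fM (x, t); rewrite ler_norml => /andP[+ _]; rewrite /= -subr_ge0 opprK.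
split; last first.
  exists M => x; rewrite -[leRHS](ex_cst P).
  by apply: norm_ex_le => // [|t]; [exact: bmeas_cst|exact: (fM (x, t))].
have -> : (fun x => ex P (f x)) = fun x => fine (\int[P]_t (f x t + M)%:E)%E - M.
  apply/funext => x; have -> : fine (\int[P]_t (f x t + M)%:E)%E =
      ex P (fun t => f x t + M) by [].
  by rewrite exD ?ex_cst ?addrK//; exact: bmeas_cst.
apply: measurable_funB => //.
apply: measurableT_comp => //.
apply: (measurable_fun_fubini_tonelli_F (fun w => (f w.1 w.2 + M)%:E)) => //=.
  by apply/measurable_EFinP; exact: measurable_funD.
by move=> w; rewrite lee_fin; exact: fM0.
Qed.

End iterated.

Section fubini.
Context {d d' : measure_display} {X : measurableType d}
  {T : measurableType d'} {R : realType}.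
Variables (Q : probability X R) (P : probability T R).

Lemma ex_swap (f : X -> T -> R) : bmeas (fun w : X * T => f w.1 w.2) ->
  ex Q (fun x => ex P (f x)) = ex P (fun t => ex Q (fun x => f x t)).
Proof.
move=> bf; have [mf [M fM]] := bf.
have bfx x : bmeas (f x).
  split; last by exists M => t; exact: (fM (x, t)).
  exact: (measurableT_comp mf (pair1_measurable x)).
have bft t : bmeas (fun x => f x t).
  split; last by exists M => x; exact: (fM (x, t)).
  exact: (measurableT_comp mf (pair2_measurable t)).
have ifQP : (Q \x P)%E.-integrable setT (EFin \o (fun w : X * T => f w.1 w.2)).
  exact: bmeas_integrable.
have := Fubini ifQP; rewrite /= => FQP.
have l : (\int[Q]_x (ex P (f x))%:E = \int[Q]_x \int[P]_t (f x t)%:E)%E.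
  by apply: eq_integral => x _; rewrite EFin_ex.
have r : (\int[P]_t (ex Q (f ^~ t))%:E = \int[P]_t \int[Q]_x (f x t)%:E)%E.
  by apply: eq_integral => t _; rewrite EFin_ex.
by rewrite [LHS]/ex [RHS]/ex /Rintegral l FQP r.
Qed.

End fubini.

(** * The sawtooth kernel and its triangle identities *)

Section sawtooth.
Context {R : realType}.
Implicit Types a b c r : R.

(** For [|a - b| < 1] this is the 1-periodic sawtooth [1 / 2 - {a - b}], with value 0 at the
    jump. *)
Definition psi a b : R := Num.sg (a - b) / 2 - (a - b).

Lemma sgrBC a b : Num.sg (a - b) = - Num.sg (b - a).
Proof. by rewrite -opprB sgrN. Qed.

Lemma psiC a b : psi a b = - psi b a.
Proof. by rewrite /psi sgrBC; field. Qed.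

(** If the first two signs agree, the third equals them; if they are opposite, they cancel in the
    sum and multiply to -1. When two of the points coincide, both sides vanish. *)
Lemma sg_triangle a b r :
  Num.sg (a - r) * Num.sg (r - b) * Num.sg (a - b) =
  Num.sg (a - r) + Num.sg (r - b) - Num.sg (a - b).
Proof.
by case: (sgrP (a - r)) => ?; case: (sgrP (r - b)) => ?;
  case: (sgrP (a - b)) => ?; lra.
Qed.

(** The linear parts of [psi] cancel around the triangle, so only [sg_triangle] remains. *)
Lemma psi_triangle a b r :
  Num.sg (a - r) * Num.sg (r - b) * Num.sg (a - b) =
  2 * (psi a r + psi r b - psi a b).
Proof. by rewrite sg_triangle /psi; field. Qed.

Lemma sqr_sgB a b : a != b -> Num.sg (a - b) ^+ 2 = 1.
Proof. by move=> ab; rewrite sqr_sg subr_eq0 ab. Qed.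

(** The base is half a product of three signs. Expanding the square expresses a product of two
    values of [psi] through the remaining squares and products. *)
Lemma psi_triangle2 a b r : a != b -> r != a -> r != b ->
  (psi a r + psi r b - psi a b) ^+ 2 = 1 / 4.
Proof.
move=> ab ra rb.
have -> : psi a r + psi r b - psi a b =
    Num.sg (a - r) * Num.sg (r - b) * Num.sg (a - b) / 2.
  by rewrite psi_triangle; field.
by rewrite !exprMn !sqr_sgB// 1?eq_sym//; field.
Qed.

Lemma sqr_sg_psi a b : (Num.sg (a - b) * psi a b) ^+ 2 = psi a b ^+ 2.
Proof.
have [->|ab] := eqVneq a b; last by rewrite exprMn sqr_sgB// mul1r.
by rewrite /psi subrr sgr0; field.
Qed.

Lemma norm_psi_le a b : 0 <= a <= 1 -> 0 <= b <= 1 -> `|psi a b| <= 1 / 2.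
Proof.
move=> /andP[a0 a1] /andP[b0 b1]; rewrite /psi ler_norml.
by case: sgrP => ab; apply/andP; split; lra.
Qed.

End sawtooth.

Lemma bmeas_psi {d : measure_display} {X : measurableType d} {R : realType}
    (f g : X -> R) : bmeas f -> bmeas g -> bmeas (fun x => psi (f x) (g x)).
Proof.
move=> bf bg; have bfg := bmeasD bf (bmeasN bg).
apply: bmeasD (bmeasN bfg); apply: bmeasM (bmeas_cst _).
exact: bmeas_sg.
Qed.

(** * Automation for measurability *)

Section measurable_projections.
Context {d1 d2 d3 : measure_display} {X : measurableType d1}
  {Y : measurableType d2} {Z : measurableType d3}.

Lemma measurable_fun_fst (f : X -> Y * Z) :
  measurable_fun setT f -> measurable_fun setT (fun x => (f x).1).
Proof. by move=> mf; exact: (measurableT_comp measurable_fst mf). Qed.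

Lemma measurable_fun_snd (f : X -> Y * Z) :
  measurable_fun setT f -> measurable_fun setT (fun x => (f x).2).
Proof. by move=> mf; exact: (measurableT_comp measurable_snd mf). Qed.

End measurable_projections.

Ltac measurable_proj := cbv beta; lazymatch goal with
  | |- measurable_fun _ (fun x => x) => exact: measurable_id
  | |- measurable_fun _ fst => exact: measurable_fst
  | |- measurable_fun _ snd => exact: measurable_snd
  | |- measurable_fun _ (fun _ => ?c) => exact: measurable_cst
  | |- measurable_fun _ (fun x => (@?f x, @?g x)) =>
      refine (@measurable_fun_pair _ _ _ _ _ _ f g _ _); measurable_proj
  | |- measurable_fun _ (fun x => fst (@?f x)) =>
      refine (@measurable_fun_fst _ _ _ _ _ _ f _); measurable_proj
  | |- measurable_fun _ (fun x => snd (@?f x)) =>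
      refine (@measurable_fun_snd _ _ _ _ _ _ f _); measurable_proj
  end.
(** Structural search: arithmetic, [sg], [psi] and inner expectations are peeled off, and a leaf
    [F (g x)] or [F (g1 x) (g2 x)] is closed by a hypothesis on [F], uncurried in the second case,
    composed with projections. *)
Ltac bm := cbv beta; lazymatch goal with
  | |- bmeas (fun _ => ?c) => exact (bmeas_cst c)
  | |- bmeas (fun x => GRing.add (@?f x) (@?g x)) =>
      refine (@bmeasD _ _ _ f g _ _); bm
  | |- bmeas (fun x => GRing.opp (@?f x)) => refine (@bmeasN _ _ _ f _); bm
  | |- bmeas (fun x => GRing.mul (@?f x) (@?g x)) =>
      refine (@bmeasM _ _ _ f g _ _); bm
  | |- bmeas (fun x => GRing.exp (@?f x) ?n) => refine (@bmeasX _ _ _ f n _); bm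
  | |- bmeas (fun x => Num.sg (@?f x)) => refine (@bmeas_sg _ _ _ f _); bm
  | |- bmeas (fun x => psi (@?f x) (@?g x)) =>
      refine (@bmeas_psi _ _ _ f g _ _); bm
  | |- bmeas (fun x => ex ?P (@?f x)) =>
      refine (@bmeas_ex _ _ _ _ _ P f _); bm
  | |- bmeas ?f => first [assumption | lazymatch f with
    | (fun x => ?F (@?g1 x) (@?g2 x)) =>
        match goal with H : bmeas (fun w => F w.1 w.2) |- _ =>
          refine (bmeas_comp (g := fun x => (g1 x, g2 x)) H _);
          solve [measurable_proj] end
    | (fun x => ?F (@?g x)) =>
        match goal with H : bmeas F |- _ =>
          refine (bmeas_comp (g := g) H _); solve [measurable_proj] end
    end]
  end.

(** * Moments of one uniform coordinate *)

Section uniform_coordinate.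
Context {d : measure_display} {T : measurableType d} {R : realType}.
Variable P : probability T R.
Local Notation E := (ex P).

(* [E (sg (c - U)) = 2 c - 1] says that the atomless variable [U] has the
   uniform distribution function on [0, 1]. *)
Record uniform_coord (U : T -> R) : Prop := UniformCoord {
  uc_meas : measurable_fun setT U;
  uc_itv : forall p, 0 <= U p <= 1;
  uc_atomless : forall c, P [set p | U p = c] = 0%E;
  uc_sg : forall c, 0 <= c <= 1 -> E (fun r => Num.sg (c - U r)) = 2 * c - 1 }.

Variable U : T -> R.
Hypothesis uU : uniform_coord U.

Lemma bmeas_coord : bmeas U.
Proof.
split; first exact: uc_meas uU.
by exists 1 => p; have /andP[U0 U1] := uc_itv uU p; rewrite ger0_norm.
Qed.

Lemma measurable_fiber c : measurable [set p | U p = c].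
Proof.
rewrite -[X in measurable X]setTI.
exact: (uc_meas uU measurableT (measurable_set1 c)).
Qed.

Lemma fibers_null (s : seq R) :
  measurable [set p | U p \in s] /\ P [set p | U p \in s] = 0%E.
Proof.
elim: s => [|c s [ms Ps]].
  by rewrite (_ : [set _ | _] = set0) ?measure0// -subset0 => p.
have -> : [set p | U p \in c :: s] = [set p | U p = c] `|` [set p | U p \in s].
  apply/seteqP; split => p /=; rewrite in_cons.
    by case/orP => [/eqP|]; [left|right].
  by case=> [->|->]; rewrite ?eqxx ?orbT.
split; first by apply: measurableU => //; exact: measurable_fiber.
by rewrite measureU0//; [exact: uc_atomless|exact: measurable_fiber].
Qed.

Let bU := bmeas_coord.
Ltac side := try solve [bm | assumption | exact: (uc_itv uU)].

Lemma eq_ex_coord (s : seq R) f g : bmeas f -> bmeas g ->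
  (forall r, U r \notin s -> f r = g r) -> E f = E g.
Proof.
move=> bf bg fg; have [ms Ps] := fibers_null s.
by apply: (eq_ex_null ms Ps) => // r /negP; exact: fg.
Qed.

(** The mean of [sg (U r - U s)] over both points is [2 * E U - 1], and it is zero by
    antisymmetry. *)
Lemma ex_coord : E U = 1 / 2.
Proof.
have l : E (fun r => E (fun s => Num.sg (U r - U s))) = 2 * E U - 1.
  rewrite -[X in _ - X](ex_cst P) -exZl// -exB//; [|by bm|by bm].
  by apply: eq_ex => r; rewrite uc_sg//; exact: uc_itv.
have : E (fun r => E (fun s => Num.sg (U r - U s))) =
    - E (fun r => E (fun s => Num.sg (U r - U s))).
  rewrite {1}ex_swap; last by bm.
  rewrite -exN; last by bm.
  apply: eq_ex => r; rewrite -exN; last by bm.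
  by apply: eq_ex => s; exact: sgrBC.
by rewrite l; lra.
Qed.

(** Writing [U] as a mean of signs reduces its moments to sign identities and Fubini. *)
Lemma coord_eq_ex r : U r = (1 + E (fun s => Num.sg (U r - U s))) / 2.
Proof. by rewrite uc_sg ?uc_itv//; field. Qed.

(** Symmetrised in [r] and [s], the integrand becomes [sg (c - U r) * sg (c - U s) - 1] by
    [sg_triangle], whose mean factors. *)
Lemma ex_sg_sg c : 0 <= c <= 1 ->
  E (fun r => Num.sg (c - U r) * E (fun s => Num.sg (U r - U s))) =
  2 * c ^+ 2 - 2 * c.
Proof.
move=> c01.
pose N := E (fun r => E (fun s => Num.sg (c - U r) * Num.sg (U r - U s))).
have -> : E (fun r => Num.sg (c - U r) * E (fun s => Num.sg (U r - U s))) = N.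
  by apply: eq_ex => r; rewrite exZl//; bm.
have N' : N = E (fun r => E (fun s => Num.sg (c - U s) * Num.sg (U s - U r))).
  by rewrite /N ex_swap//; bm.
suff : N + N = (2 * c - 1) ^+ 2 - 1 by nra.
have -> : (2 * c - 1) ^+ 2 - 1 =
    E (fun r => E (fun s => Num.sg (c - U r) * Num.sg (c - U s) - 1)).
  transitivity (E (fun r => Num.sg (c - U r) * (2 * c - 1) - 1)).
    by rewrite exB ?exZr ?ex_cst ?uc_sg; side; ring.
  by apply: eq_ex => r; rewrite exB ?exZl ?ex_cst ?uc_sg; side.
rewrite {2}N' {1}/N -exD; [|by bm|by bm].
apply: (eq_ex_coord (s := [:: c])); [by bm|by bm|move=> r].
rewrite inE => rc; rewrite -exD; [|by bm|by bm].
apply: (eq_ex_coord (s := [:: c; U r])); [by bm|by bm|move=> s].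
rewrite !inE negb_or => /andP[sc sr].
have t := sg_triangle c (U s) (U r).
have := sqr_sgB sr; rewrite (sgrBC (U s) (U r)) sqrrN.
move: t; set x := Num.sg (c - U r); set y := Num.sg (U r - U s).
set z := Num.sg (c - U s) => t y2.
have xz : x - z = x * y * z - y by rewrite t; ring.
have -> : x * y + z * - y = y * (x - z) by ring.
have -> : y * (x - z) = y ^+ 2 * (x * z - 1) by rewrite xz; ring.
by rewrite y2; ring.
Qed.

Lemma ex_sg_coord c : 0 <= c <= 1 ->
  E (fun r => Num.sg (c - U r) * U r) = c ^+ 2 - 1 / 2.
Proof.
move=> c01; transitivity (E (fun r => (1 / 2) * Num.sg (c - U r) +
    (1 / 2) * (Num.sg (c - U r) * E (fun s => Num.sg (U r - U s))))).
  by apply: eq_ex => r; rewrite [X in _ * X = _]coord_eq_ex; field.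
rewrite exD ?exZl ?uc_sg ?ex_sg_sg; side.
by field.
Qed.

(** Replacing one factor by its mean of signs and swapping the expectations brings back
    [1 / 2 - E (U ^ 2)], so the second moment solves a linear equation. *)
Lemma ex_coord2 : E (fun r => U r ^+ 2) = 1 / 3.
Proof.
have : E (fun r => U r ^+ 2) =
    E (fun r => (1 / 2) * U r + (1 / 2) * (U r * E (fun s => Num.sg (U r - U s)))).
  by apply: eq_ex => r; rewrite expr2 [X in _ * X = _]coord_eq_ex; field.
rewrite exD ?exZl ?ex_coord; side.
have -> : E (fun r => U r * E (fun s => Num.sg (U r - U s))) =
    E (fun s => - (U s ^+ 2 - 1 / 2)).
  transitivity (E (fun r => E (fun s => U r * Num.sg (U r - U s)))).
    by apply: eq_ex => r; rewrite exZl//; bm.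
  rewrite ex_swap; last by bm.
  apply: eq_ex => s; rewrite -ex_sg_coord ?uc_itv// -exN; last by bm.
  by apply: eq_ex => r; rewrite sgrBC; ring.
rewrite exN ?exB ?ex_cst; side.
by lra.
Qed.

Lemma ex_psi c : 0 <= c <= 1 -> E (fun r => psi c (U r)) = 0.
Proof.
move=> c01; rewrite /psi exB ?exZr ?uc_sg ?exB ?ex_cst ?ex_coord; side.
by field.
Qed.

Lemma ex_psi2 c : 0 <= c <= 1 -> E (fun r => psi c (U r) ^+ 2) = 1 / 12.
Proof.
move=> c01; transitivity (E (fun r => 1 / 4 + c ^+ 2 - 2 * c * U r + U r ^+ 2
    - c * Num.sg (c - U r) + Num.sg (c - U r) * U r)).
  apply: (eq_ex_coord (s := [:: c])); [by bm|by bm|move=> r].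
  rewrite inE eq_sym => /sqr_sgB c2; rewrite /psi.
  move: c2; set x := Num.sg _ => x2.
  have -> : (x / 2 - (c - U r)) ^+ 2 = x ^+ 2 / 4 - x * (c - U r) + (c - U r) ^+ 2.
    by field.
  by rewrite x2; ring.
rewrite !(exD, exN, exZl, ex_cst, ex_coord, ex_coord2, uc_sg, ex_sg_coord);
  side.
by field.
Qed.

(** The mean of [psi_triangle2] over the third point: the products with [psi a b] average to zero
    and the two squares to 1/12 each. *)
Lemma ex_psi_psi a b : 0 <= a <= 1 -> 0 <= b <= 1 -> a != b ->
  E (fun r => psi a (U r) * psi b (U r)) = psi a b ^+ 2 / 2 - 1 / 24.
Proof.
move=> a01 b01 ab.
have : E (fun r => (1 / 2) * psi a (U r) ^+ 2 + (1 / 2) * psi b (U r) ^+ 2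
   + (psi a b ^+ 2 / 2 - 1 / 8) - psi a b * psi a (U r) + psi a b * psi b (U r)) =
   E (fun r => psi a (U r) * psi b (U r)).
  apply: (eq_ex_coord (s := [:: a; b])); [by bm|by bm|].
  move=> r; rewrite !inE negb_or => /andP[ra rb].
  by have := psi_triangle2 ab ra rb; rewrite (psiC (U r) b); lra.
rewrite !(exD, exN, exZl, ex_cst, ex_psi, ex_psi2); side.
by move=> <-; field.
Qed.

End uniform_coordinate.

(** * Expectations over two independent points *)

Section two_points.
Context {d : measure_display} {T : measurableType d} {R : realType}.
Variable P : probability T R.
Local Notation E := (ex P).
Implicit Types f g : T -> T -> R.

Definition ex2 f := E (fun p => E (f p)).

Let bmeas2 f := bmeas (fun w : T * T => f w.1 w.2).

Lemma bmeas_curry f p : bmeas2 f -> bmeas (f p).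
Proof.
move=> bf; apply: (bmeas_comp (g := fun q => (p, q)) bf).
exact: pair1_measurable.
Qed.

Lemma eq_ex2 f g : (forall p q, f p q = g p q) -> ex2 f = ex2 g.
Proof. by move=> fg; apply: eq_ex => p; apply: eq_ex => q. Qed.

Lemma ex2D f g : bmeas2 f -> bmeas2 g ->
  ex2 (fun p q => f p q + g p q) = ex2 f + ex2 g.
Proof.
move=> bf bg; rewrite /ex2 -exD; [|exact: bmeas_ex|exact: bmeas_ex].
by apply: eq_ex => p; rewrite exD//; exact: bmeas_curry.
Qed.

Lemma ex2Z c f : bmeas2 f -> ex2 (fun p q => c * f p q) = c * ex2 f.
Proof.
move=> bf; rewrite /ex2 -exZl; last exact: bmeas_ex.
by apply: eq_ex => p; rewrite exZl//; exact: bmeas_curry.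
Qed.

Lemma ex2_cst c : ex2 (fun _ _ => c) = c.
Proof. by rewrite /ex2 ex_cst ex_cst. Qed.

Lemma ex2_swap f : bmeas2 f -> ex2 f = ex2 (fun p q => f q p).
Proof. exact: ex_swap. Qed.

Lemma ex2_prod (f g : T -> R) : bmeas f -> bmeas g ->
  ex2 (fun p q => f p * g q) = E f * E g.
Proof.
move=> bf bg; rewrite /ex2 -exZr//; apply: eq_ex => p.
by rewrite exZl.
Qed.

End two_points.

(** * Two coordinates: the lower bound for the mean square of [codegree] *)

Section two_coordinates.
Context {d : measure_display} {T : measurableType d} {R : realType}.
Variable P : probability T R.
Local Notation E := (ex P).
Local Notation E2 := (ex2 P).
Variables X Y : T -> R.
Hypotheses (uX : uniform_coord P X) (uY : uniform_coord P Y).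
Let bX := bmeas_coord uX.
Let bY := bmeas_coord uY.

Lemma eq_ex_coords (s t : seq R) f g : bmeas f -> bmeas g ->
  (forall r, X r \notin s -> Y r \notin t -> f r = g r) -> E f = E g.
Proof.
move=> bf bg fg; have [ms Ps] := fibers_null uX s.
have [mt Pt] := fibers_null uY t.
apply: (eq_ex_null (A := [set p | X p \in s] `|` [set p | Y p \in t])) => //.
- exact: measurableU.
- by rewrite measureU0.
- by move=> r /not_orP[/negP rs /negP rt]; exact: fg.
Qed.

Lemma eq_ex2_coords f g : bmeas (fun w : T * T => f w.1 w.2) ->
  bmeas (fun w : T * T => g w.1 w.2) ->
  (forall p q, X p != X q -> Y p != Y q -> f p q = g p q) -> E2 f = E2 g.
Proof.
move=> bf bg fg; apply: eq_ex => p.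
apply: (eq_ex_coords (s := [:: X p]) (t := [:: Y p]));
  [exact: bmeas_curry|exact: bmeas_curry|move=> q].
by rewrite !inE => Xqp Yqp; apply: fg; rewrite eq_sym.
Qed.

Local Notation x p q := (psi (X p) (X q)).
Local Notation y p q := (psi (Y p) (Y q)).

Definition concord p q := Num.sg (X p - X q) * Num.sg (Y p - Y q).
Local Notation K := concord.

Lemma bmeas_concord : bmeas (fun w : T * T => K w.1 w.2).
Proof. by rewrite /concord; bm. Qed.
Let bK := bmeas_concord.

Definition codegree p q := E (fun r => K p r * K r q).
Local Notation K2 := codegree.

Lemma bmeas_codegree : bmeas (fun w : T * T => K2 w.1 w.2).
Proof. by rewrite /codegree; bm. Qed.
Let bK2 := bmeas_codegree.

Definition copula_gap a b := E (fun r => psi a (X r) * psi b (Y r)).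
Local Notation D := copula_gap.

Let bD : bmeas (fun w : T * T => D (X w.1) (Y w.2)).
Proof. by rewrite /copula_gap; bm. Qed.

Ltac side := try solve [bm | assumption | rewrite /copula_gap; bm | exact: (uc_itv uX) | exact: (uc_itv uY)].

(** Here the average is over the product of the marginals, that is, over the uniform law of the
    square, so that its vanishing forces [D = 0] everywhere; [gap_diag] averages over the joint law
    of [X] and [Y]. *)
Definition gap_prod := E2 (fun p q => D (X p) (Y q) ^+ 2).
Definition gap_diag := E (fun p => D (X p) (Y p) ^+ 2).
Local Notation J := gap_prod.
Local Notation S := gap_diag.

(** Opens one factor [D] as a mean over a third point; the two sign changes from [psiC] cancel. *)
Lemma ex2_gap (G : T -> T -> R) : bmeas (fun w : T * T => G w.1 w.2) ->
  E2 (fun p q => D (X p) (Y q) * G p q) =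
  E (fun r => E2 (fun p q => x r p * y r q * G p q)).
Proof.
move=> bG; transitivity (E (fun p => E (fun r => E (fun q =>
    x r p * y r q * G p q)))); last first.
  by rewrite ex_swap; last by bm.
apply: eq_ex => p; have bGp := bmeas_curry p bG.
rewrite ex_swap; last by bm.
apply: eq_ex => q; rewrite /copula_gap -exZr; last by bm.
by apply: eq_ex => r; rewrite [in RHS]psiC (psiC (Y r)); ring.
Qed.

(** Once both factors [D] are opened by [ex2_gap], at points [r] and [s], the integrals over [p] and
    [q] separate and [ex_psi_psi] evaluates each. *)
Lemma gap_prodE :
  J = E2 (fun r s => (x r s ^+ 2 / 2 - 1 / 24) * (y r s ^+ 2 / 2 - 1 / 24)).
Proof.
transitivity (E2 (fun r s =>
    E (fun p => x r p * x s p) * E (fun q => y r q * y s q))).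
  rewrite /gap_prod.
  transitivity (E2 (fun p q => D (X p) (Y q) * D (X p) (Y q))).
    by apply: eq_ex2 => p q; rewrite expr2.
  rewrite ex2_gap; last exact: bD.
  apply: eq_ex => r.
  transitivity (E2 (fun p q => D (X p) (Y q) * (x r p * y r q))).
    by apply: eq_ex2 => p q; rewrite mulrC.
  rewrite ex2_gap; last by bm.
  apply: eq_ex => s; rewrite -ex2_prod; [|by bm|by bm].
  by apply: eq_ex2 => p q; ring.
apply: eq_ex2_coords; [by bm|by bm|move=> r s Xrs Yrs].
by rewrite (ex_psi_psi uX) ?(ex_psi_psi uY); side.
Qed.

(** This solves [gap_prodE] for the mixed term, each square alone having mean 1/12. *)
Let xy2 : E2 (fun p q => x p q ^+ 2 * y p q ^+ 2) = 1 / 144 + 4 * J.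
Proof.
rewrite gap_prodE.
have -> : E2 (fun r s => (x r s ^+ 2 / 2 - 1 / 24) * (y r s ^+ 2 / 2 - 1 / 24)) =
  E2 (fun r s => 1 / 4 * (x r s ^+ 2 * y r s ^+ 2) + (- (1 / 48)) * x r s ^+ 2 +
      (- (1 / 48)) * y r s ^+ 2 + 1 / 576).
  by apply: eq_ex2 => p q; field.
have x2 : E2 (fun r s => x r s ^+ 2) = 1 / 12.
  by rewrite -(ex_cst P (1 / 12)); apply: eq_ex => p; rewrite ex_psi2; side.
have y2 : E2 (fun r s => y r s ^+ 2) = 1 / 12.
  by rewrite -(ex_cst P (1 / 12)); apply: eq_ex => p; rewrite ex_psi2; side.
rewrite !(ex2D, ex2Z, ex2_cst); side.
by rewrite x2 y2; field.
Qed.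

(* [2 * (sg (a - b) * psi a b)] is [1 - 2 |a - b|], except that it vanishes at
   [a = b]; with this value the identities below need no genericity. *)
Definition test_kernel p q :=
  4 * (Num.sg (X p - X q) * x p q) * (Num.sg (Y p - Y q) * y p q).
Local Notation h := test_kernel.

Let bh : bmeas (fun w : T * T => h w.1 w.2).
Proof. by rewrite /test_kernel; bm. Qed.

Lemma ex2_test2 : E2 (fun p q => h p q ^+ 2) = 1 / 9 + 64 * J.
Proof.
transitivity (E2 (fun p q => 16 * (x p q ^+ 2 * y p q ^+ 2))).
  by apply: eq_ex2 => p q; rewrite /test_kernel exprMn sqr_sg_psi exprMn sqr_sg_psi; ring.
by rewrite ex2Z ?xy2; side; field.
Qed.

(** The signs of [K p r * K r q] and of [h p q] regroup into one triangle for each coordinate. By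
    [psi_triangle] each becomes a sum of values of [psi], and averaging the product of the two sums
    over [r] yields the terms in [D]. *)
Lemma codegree_test p q : K2 p q * h p q = 16 * (x p q * y p q *
  (D (X p) (Y p) + D (X q) (Y q) - D (X p) (Y q) - D (X q) (Y p) + x p q * y p q)).
Proof.
rewrite /codegree -exZr; last by bm.
transitivity (E (fun r => 16 * (x p q * y p q) * (
   x p r * y p r + x q r * y q r + - (x p r * y q r) + - (x q r * y p r)
   + (- y p q) * x p r + y p q * x q r + (- x p q) * y p r + x p q * y q r
   + x p q * y p q))).
  apply: eq_ex => r; rewrite /concord /test_kernel.
  have tx := psi_triangle (X p) (X q) (X r); have ty := psi_triangle (Y p) (Y q) (Y r).
  transitivity (4 * (x p q * y p q) *
    (Num.sg (X p - X r) * Num.sg (X r - X q) * Num.sg (X p - X q)) *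
    (Num.sg (Y p - Y r) * Num.sg (Y r - Y q) * Num.sg (Y p - Y q))); first by ring.
  by rewrite tx ty (psiC (X r)) (psiC (Y r)); ring.
rewrite exZl; last by bm.
rewrite !(exD, exN, exZl, ex_cst, ex_psi uX, ex_psi uY); side.
by rewrite /copula_gap; ring.
Qed.

Let ex_rev (f : T -> T -> T -> R) :
  bmeas (fun w : T * T * T => f w.1.1 w.1.2 w.2) ->
  E (fun p => E (fun q => E (f p q))) =
  E (fun p => E (fun q => E (fun r => f r q p))).
Proof.
move=> bf.
have bs (g1 g2 g3 : T * T * T -> T) : measurable_fun setT g1 ->
    measurable_fun setT g2 -> measurable_fun setT g3 ->
    bmeas (fun w => f (g1 w) (g2 w) (g3 w)).
  move=> m1 m2 m3; apply: (bmeas_comp (g := fun w => (g1 w, g2 w, g3 w)) bf).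
  by apply: measurable_fun_pair => //; exact: measurable_fun_pair.
have bfp p : bmeas (fun w : T * T => f p w.1 w.2).
  apply: (bmeas_comp (g := fun w : T * T => (p, w.1, w.2)) bf).
  by measurable_proj.
have bfr r : bmeas (fun w : T * T => f w.1 w.2 r).
  apply: (bmeas_comp (g := fun w : T * T => (w.1, w.2, r)) bf).
  by measurable_proj.
transitivity (E (fun p => E (fun r => E (fun q => f p q r)))).
  by apply: eq_ex => p; rewrite ex_swap.
rewrite ex_swap; last by apply: bmeas_ex; apply: bs; measurable_proj.
by apply: eq_ex => p; rewrite ex_swap.
Qed.

(** The identity [psi_triangle2] turns [2 * W] into [A + B + 2 * C + 2 * G] in the mean. Since [C]
    has mean [- E2 W], this is a linear equation for [E2 W]. *)
Lemma ex2_gap_cross :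
  E2 (fun p q => x p q * y p q * D (X p) (Y q)) = (S - J) / 2.
Proof.
have lin (w s j : R) : 2 * w = - (2 * j) + 0 + 2 * - w + 2 * s ->
  w = (s - j) / 2 by lra.
pose A p q := y p q * E (fun r => x p r ^+ 2 * y q r).
pose B p q := y p q * E (fun r => x q r ^+ 2 * y q r).
pose C p q := y p q * E (fun r => x p r * x r q * y q r).
pose G p q := x p q * y p q * D (X q) (Y q).
pose W p q := x p q * y p q * D (X p) (Y q).
change (E2 W = (S - J) / 2).
have bA : bmeas (fun w : T * T => A w.1 w.2) by rewrite /A; bm.
have bB : bmeas (fun w : T * T => B w.1 w.2) by rewrite /B; bm.
have bC : bmeas (fun w : T * T => C w.1 w.2) by rewrite /C; bm.
have bG : bmeas (fun w : T * T => G w.1 w.2) by rewrite /G /copula_gap; bm.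
have bW : bmeas (fun w : T * T => W w.1 w.2) by rewrite /W /copula_gap; bm.
(* The identity for [x] is solved for [2 * x p q * x p r] and multiplied by [y p q * y q r]; the
   term in [x p q ^+ 2 - 1 / 4] then has mean zero over [r]. *)
have WE : E2 (fun p q => 2 * W p q) =
    E2 (fun p q => A p q + B p q + 2 * C p q + 2 * G p q).
  apply: eq_ex2_coords; [by bm|by bm|move=> p q Xpq Ypq].
  transitivity (E (fun r => (2 * (x p q * y p q)) * (x p r * y q r))).
    by rewrite exZl; side; rewrite /W /copula_gap; ring.
  transitivity (E (fun r => y p q * (x p r ^+ 2 * y q r) +
      y p q * (x q r ^+ 2 * y q r) + (2 * y p q) * (x p r * x r q * y q r) +
      (2 * (x p q * y p q)) * (x q r * y q r) +
      (x p q ^+ 2 - 1 / 4) * y p q * y q r)).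
    apply: (eq_ex_coord (U := X) uX (s := [:: X p; X q])); side.
    move=> r; rewrite !inE negb_or => /andP[rp rq].
    have <- := psi_triangle2 Xpq rp rq.
    by rewrite (psiC (X q) (X r)); ring.
  rewrite !(exD, exZl, ex_psi uY); side.
  by rewrite /A /B /C /G /copula_gap; ring.
(* Averaging [y p q * y q r] over [q] first gives [1 / 24 - y p r ^+ 2 / 2]; with [xy2] the
   constants cancel. *)
have AE : E2 A = - (2 * J).
  transitivity (E (fun p => E (fun r => E (fun q => y p q * (x p r ^+ 2 * y q r))))).
    apply: eq_ex => p; rewrite [RHS]ex_swap; side.
    by apply: eq_ex => q; rewrite /A exZl; side.
  transitivity (E2 (fun p r => (- (1 / 2)) * (x p r ^+ 2 * y p r ^+ 2) +
      (1 / 24) * x p r ^+ 2)).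
    apply: eq_ex2_coords; [by bm|by bm|move=> p r Xpr Ypr].
    transitivity (E (fun q => (- x p r ^+ 2) * (y p q * y r q))).
      by apply: eq_ex => q; rewrite (psiC (Y q)); ring.
    by rewrite exZl; side; rewrite (ex_psi_psi uY); side; field.
  have x2 : E2 (fun r s => x r s ^+ 2) = 1 / 12.
    by rewrite -(ex_cst P (1 / 12)); apply: eq_ex => p; rewrite ex_psi2; side.
  by rewrite !(ex2D, ex2Z, xy2, x2); side; field.
(* Only the factor [y p q] depends on [p], and its mean over [p] is zero. *)
have BE : E2 B = 0.
  rewrite (ex2_swap P bB) -(ex_cst P 0); apply: eq_ex => q.
  rewrite /B exZr; side.
  transitivity (- E (fun p => y q p) * E (fun r => x q r ^+ 2 * y q r)).
    by rewrite -exN; side; congr (_ * _); apply: eq_ex => p; rewrite psiC.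
  by rewrite ex_psi; side; rewrite oppr0 mul0r.
(* Exchanging [p] and [r] gives the integrand of [W] after three sign changes. *)
have CE : E2 C = - E2 W.
  transitivity (E (fun p => E (fun q => E (fun r =>
      y p q * (x p r * x r q * y q r))))).
    by apply: eq_ex2 => p q; rewrite /C exZl; side.
  rewrite ex_rev; side.
  rewrite -mulN1r -(ex2Z P (-1) bW).
  apply: eq_ex2 => p q; rewrite /W /copula_gap -exZl; side.
  rewrite -exZl; side.
  apply: eq_ex => r; rewrite (psiC (X r) (X p)) (psiC (Y r)) (psiC (Y q) (Y p)).
  by ring.
have GE : E2 G = S.
  rewrite (ex2_swap P bG); apply: eq_ex => p.
  rewrite /G exZr; side.
  rewrite expr2; congr (_ * _); rewrite /copula_gap; apply: eq_ex => q.
  by rewrite psiC (psiC (Y q)); ring.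
have b2C : bmeas (fun w : T * T => 2 * C w.1 w.2) by bm.
have b2G : bmeas (fun w : T * T => 2 * G w.1 w.2) by bm.
move: WE; rewrite (ex2Z P 2 bW).
rewrite (ex2D P (bmeasD (bmeasD bA bB) b2C) b2G) (ex2D P (bmeasD bA bB) b2C).
rewrite (ex2D P bA bB) (ex2Z P 2 bC) (ex2Z P 2 bG) AE BE CE GE.
exact: lin.
Qed.

(** In the expansion of the square of [K2 - h], the product [K2 * h] has mean
    [1 / 9 + 80 * J + 16 * S] and [h ^+ 2] has mean [1 / 9 + 64 * J]; twice the first minus the
    second is the bound. *)
Lemma codegree_sqr_ge :
  1 / 9 + 96 * J + 32 * S <= E2 (fun p q => K2 p q ^+ 2).
Proof.
have lin (k j s : R) :
    0 <= k + - 2 * (16 * (2 * s - 2 * ((s - j) / 2) + 1 / 144 + 4 * j)) +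
      (1 / 9 + 64 * j) -> 1 / 9 + 96 * j + 32 * s <= k by lra.
have : 0 <= E2 (fun p q => (K2 p q - h p q) ^+ 2).
  by apply: ex_ge0 => p; apply: ex_ge0 => q; exact: sqr_ge0.
have -> : E2 (fun p q => (K2 p q - h p q) ^+ 2) =
    E2 (fun p q => K2 p q ^+ 2 + (- 2) * (K2 p q * h p q) + h p q ^+ 2).
  by apply: eq_ex2 => p q; ring.
rewrite !ex2D; side.
rewrite ex2Z; side.
rewrite ex2_test2.
pose W p q := x p q * y p q * D (X p) (Y q).
pose G p q := x p q * y p q * D (X p) (Y p).
have bW : bmeas (fun w : T * T => W w.1 w.2) by rewrite /W /copula_gap; bm.
have bG : bmeas (fun w : T * T => G w.1 w.2) by rewrite /G /copula_gap; bm.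
have GE : E2 G = S.
  apply: eq_ex => p; rewrite /G exZr; side.
  by rewrite expr2.
have -> : E2 (fun p q => K2 p q * h p q) = 16 * (2 * S - 2 * E2 W + 1 / 144 + 4 * J).
  transitivity (16 * E2 (fun p q => G p q + G q p + (- 1) * W p q + (- 1) * W q p
      + x p q ^+ 2 * y p q ^+ 2)).
    rewrite -ex2Z; side.
    apply: eq_ex2 => p q; rewrite codegree_test /G /W.
    by rewrite (psiC (X q) (X p)) (psiC (Y q)); ring.
  rewrite !ex2D; side.
  rewrite !ex2Z; side.
  by rewrite -(ex2_swap P bG) -(ex2_swap P bW) GE xy2; ring.
by rewrite ex2_gap_cross; exact: lin.
Qed.

End two_coordinates.

(** * Rigidity: a vanishing gap makes the signs uncorrelated *)

Section window.
Context {R : realType}.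

(** For [a < b] this is the indicator of the interval, with value 1/2 at both ends; written with
    signs, its mean follows from [uc_sg]. *)
Definition window (a b u : R) := (Num.sg (b - u) - Num.sg (a - u)) / 2.

Lemma window_ge0 a b u : a <= b -> 0 <= window a b u.
Proof.
move=> ab; rewrite /window.
by case: (sgrP (b - u)) => ?; case: (sgrP (a - u)) => ?; lra.
Qed.

Lemma window_le1 a b u : a <= b -> window a b u <= 1.
Proof.
move=> ab; rewrite /window.
by case: (sgrP (b - u)) => ?; case: (sgrP (a - u)) => ?; lra.
Qed.

Lemma window_eq0 a b u : a <= b -> ~~ (a <= u <= b) -> window a b u = 0.
Proof.
move=> ab; rewrite negb_and -!ltNge /window => /orP[] uab.
  by rewrite !gtr0_sg ?subrr ?mul0r// subr_gt0// (lt_le_trans uab).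
by rewrite !ltr0_sg ?subrr ?mul0r// subr_lt0// (le_lt_trans ab).
Qed.

(** As [e <= 1 / 2], an interval of length [e] fits into [0,1] to the right of [a] if [a <= 1 / 2],
    and to its left otherwise. *)
Lemma window_near (a e : R) : 0 <= a <= 1 -> 0 < e <= 1 / 2 ->
  exists a1 a2, [/\ 0 <= a1 <= 1, 0 <= a2 <= 1, a1 < a2 &
    forall u, a1 <= u <= a2 -> `|u - a| <= e].
Proof.
move=> /andP[a0 a1] /andP[e0 e1]; have [ah|ah] := leP a (1 / 2).
  exists a, (a + e); split; [lra|lra|lra|].
  by move=> u /andP[u1 u2]; rewrite ler_norml; lra.
exists (a - e), a; split; [lra|lra|lra|].
by move=> u /andP[u1 u2]; rewrite ler_norml; lra.
Qed.

End window.

Section rigidity.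
Context {d : measure_display} {T : measurableType d} {R : realType}.
Variable P : probability T R.
Local Notation E := (ex P).

Lemma ex_window (U : T -> R) a b : uniform_coord P U -> 0 <= a <= 1 ->
  0 <= b <= 1 -> E (fun p => window a b (U p)) = b - a.
Proof.
move=> uU a01 b01; have bU := bmeas_coord uU.
rewrite /window exZr; last by bm.
rewrite exB; [|by bm|by bm].
by rewrite !(uc_sg uU)//; field.
Qed.

(** For [a' <= a] the difference of the factors [psi] is a window minus [a - a'], whose absolute
    value has mean at most [2 * (a - a')]; the other factor is at most 1/2. *)
Lemma copula_gap_lipl (X Y : T -> R) (a a' b : R) :
  uniform_coord P X -> uniform_coord P Y ->
  0 <= a <= 1 -> 0 <= a' <= 1 -> 0 <= b <= 1 ->
  `|copula_gap P X Y a b - copula_gap P X Y a' b| <= `|a - a'|.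
Proof.
move=> uX uY; have bX := bmeas_coord uX; have bY := bmeas_coord uY.
wlog aa' : a a' / a' <= a => [wl a01 a'01 b01|a01 a'01 b01].
  have [le|/ltW le] := leP a' a; first exact: wl.
  by rewrite distrC (distrC a); exact: wl.
rewrite (ger0_norm (x := a - a')) ?subr_ge0// /copula_gap -exB; [|by bm|by bm].
have -> : a - a' = E (fun r => (window a' a (X r) + (a - a')) * (1 / 2)).
  rewrite exZr; last by rewrite /window; bm.
  rewrite exD; [|by rewrite /window; bm|by bm].
  by rewrite ex_window// ex_cst; field.
apply: norm_ex_le; [by bm|by rewrite /window; bm|move=> r].
rewrite -mulrBl normrM ler_pM//; last first.
  by apply: norm_psi_le => //; exact: (uc_itv uY).
have -> : psi a (X r) - psi a' (X r) = window a' a (X r) - (a - a').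
  by rewrite /psi /window; field.
apply: (le_trans (ler_normB _ _)).
by rewrite !ger0_norm ?subr_ge0// window_ge0.
Qed.

Lemma copula_gapC (X Y : T -> R) a b : copula_gap P X Y a b = copula_gap P Y X b a.
Proof. by apply: eq_ex => r; rewrite mulrC. Qed.

Variables X Y : T -> R.
Hypotheses (uX : uniform_coord P X) (uY : uniform_coord P Y).
Let bX := bmeas_coord uX.
Let bY := bmeas_coord uY.
Local Notation D := (copula_gap P X Y).

Lemma copula_gap_lip a a' b b' : 0 <= a <= 1 -> 0 <= a' <= 1 ->
  0 <= b <= 1 -> 0 <= b' <= 1 -> `|D a b - D a' b'| <= `|a - a'| + `|b - b'|.
Proof.
move=> a01 a'01 b01 b'01; apply: (le_trans (ler_distD (D a' b) _ _)).
apply: lerD; first exact: copula_gap_lipl.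
by rewrite !(copula_gapC X Y a'); exact: copula_gap_lipl.
Qed.

(** By continuity [D] stays away from zero on a box near [(a, b)], and the box has positive mass
    under the product of the marginals. *)
Lemma gap_prod_gt0 a b : 0 <= a <= 1 -> 0 <= b <= 1 -> D a b != 0 ->
  0 < gap_prod P X Y.
Proof.
move=> a01 b01 D0.
(* Moving both coordinates by at most [|D a b| / 4] changes [D] by at most half of [|D a b|]; the
   cap 1/2 is for [window_near]. *)
pose e := Order.min (`|D a b| / 4) (1 / 2).
have Dgt0 : 0 < `|D a b| by rewrite normr_gt0.
have e01 : 0 < e <= 1 / 2.
  by rewrite /e lt_min ge_min lexx orbT andbT; apply/andP; split; lra.
have eD : e <= `|D a b| / 4 by rewrite ge_min lexx.
have [a1 [a2 [a101 a201 a12 na]]] := window_near a01 e01.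
have [b1 [b2 [b101 b201 b12 nb]]] := window_near b01 e01.
(* A lower bound for [D ^+ 2] on the box, whence [c * (wa p * wb q) <= D (X p) (Y q) ^+ 2]
   everywhere. *)
pose c := (`|D a b| / 2) ^+ 2.
have c0 : 0 < c by rewrite exprn_gt0// divr_gt0.
pose wa p := window a1 a2 (X p); pose wb q := window b1 b2 (Y q).
have bwa : bmeas wa by rewrite /wa /window; bm.
have bwb : bmeas wb by rewrite /wb /window; bm.
suff : c * ((a2 - a1) * (b2 - b1)) <= gap_prod P X Y.
  by apply: lt_le_trans; rewrite !mulr_gt0// subr_gt0.
rewrite -(ex_window uX a101 a201) -(ex_window uY b101 b201).
rewrite -(ex2_prod P bwa bwb) -ex2Z; last by bm.
apply: le_ex; [by bm|by rewrite /copula_gap; bm|move=> p].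
apply: le_ex; [by bm|by rewrite /copula_gap; bm|move=> q].
have [/andP[pa qb]|] := boolP ((a1 <= X p <= a2) && (b1 <= Y q <= b2)); last first.
  move=> npq; suff -> : wa p * wb q = 0 by rewrite mulr0 sqr_ge0.
  move: npq; rewrite negb_and => /orP[npa|nqb].
    by rewrite /wa window_eq0 ?mul0r// ltW.
  by rewrite /wb window_eq0 ?mulr0// ltW.
have w1 : wa p * wb q <= 1.
  by rewrite mulr_ile1// ?window_ge0 ?window_le1// ltW.
apply: (@le_trans _ _ c); first by rewrite ler_piMr// ltW.
rewrite /c -(real_normK (x := D (X p) (Y q))) ?num_real//.
rewrite ler_pXn2r ?nnegrE ?divr_ge0//.
have := copula_gap_lip (uc_itv uX p) a01 (uc_itv uY q) b01.
have := na _ pa; have := nb _ qb; have := ler_dist_dist (D (X p) (Y q)) (D a b).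
rewrite ler_norml => /andP[h1 _] h2 h3 h4.
by lra.
Qed.

(** The second difference of [D] from the corner 0 removes the linear part in the sample:
    [psi a u - psi 0 u] is [sg (a - u) / 2 + 1 / 2 - a] for [u > 0]. *)
Lemma ex_sg_sg_indep : gap_prod P X Y = 0 -> forall a b, 0 <= a <= 1 ->
  0 <= b <= 1 ->
  E (fun r => Num.sg (a - X r) * Num.sg (b - Y r)) = (2 * a - 1) * (2 * b - 1).
Proof.
move=> J0 a b a01 b01.
have D0 a' b' : 0 <= a' <= 1 -> 0 <= b' <= 1 -> D a' b' = 0.
  move=> a'01 b'01; apply/eqP; apply: contraT => /(gap_prod_gt0 a'01 b'01).
  by rewrite J0 ltxx.
have z01 : 0 <= (0 : R) <= 1 by rewrite lexx ler01.
have : D a b - D 0 b - (D a 0 - D 0 0) = 0.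
  by rewrite !D0// !subr0.
rewrite /copula_gap -exB; [|by bm|by bm].
rewrite -exB; [|by bm|by bm].
rewrite -exB; [|by bm|by bm].
have -> : E (fun r => psi a (X r) * psi b (Y r) - psi 0 (X r) * psi b (Y r) -
    (psi a (X r) * psi 0 (Y r) - psi 0 (X r) * psi 0 (Y r))) =
  E (fun r => (1 / 4) * (Num.sg (a - X r) * Num.sg (b - Y r)) +
     ((1 / 2 - b) / 2) * Num.sg (a - X r) + ((1 / 2 - a) / 2) * Num.sg (b - Y r) +
     (1 / 2 - a) * (1 / 2 - b)).
  apply: (eq_ex_coords uX uY (s := [:: 0]) (t := [:: 0])); [by bm|by bm|move=> r].
  rewrite !inE => X0 Y0; rewrite /psi !sub0r !sgrN.
  have /andP[Xge _] := uc_itv uX r; have /andP[Yge _] := uc_itv uY r.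
  by rewrite (gtr0_sg (x := X r)) ?(gtr0_sg (x := Y r)) ?lt_neqAle 1?eq_sym ?X0 ?Y0//;
    field.
rewrite !exD; try by bm.
rewrite !exZl; try by bm.
rewrite ex_cst (uc_sg uX)// (uc_sg uY)//.
by clear; set e := E _; lra.
Qed.

End rigidity.

(** * Independent coordinates attain the bound *)

Section independent_coordinates.
Context {d : measure_display} {T : measurableType d} {R : realType}.
Variable P : probability T R.
Local Notation E := (ex P).

Section one.
Variable U : T -> R.
Hypothesis uU : uniform_coord P U.
Let bU := bmeas_coord uU.

Definition sg_convol (a b : R) := E (fun r => Num.sg (a - U r) * Num.sg (U r - b)).

(** Multiplying [sg_triangle] by [sg (a - b)] and averaging over [r] shows that [sg_convol a b] is
    [2 * |a - b| - 1]. *)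
Lemma sqr_sg_convol a b : 0 <= a <= 1 -> 0 <= b <= 1 -> a != b ->
  sg_convol a b ^+ 2 = 4 * psi a b ^+ 2.
Proof.
move=> a01 b01 ab.
suff -> : sg_convol a b = -2 * (Num.sg (a - b) * psi a b).
  by rewrite exprMn sqr_sg_psi; ring.
transitivity (E (fun r => Num.sg (a - b) * (Num.sg (a - U r) +
    (- Num.sg (b - U r)) - Num.sg (a - b)))).
  apply: eq_ex => r; rewrite -sgrBC -sg_triangle.
  transitivity (Num.sg (a - b) ^+ 2 * (Num.sg (a - U r) * Num.sg (U r - b))).
    by rewrite sqr_sgB// mul1r.
  by ring.
rewrite exZl; last by bm.
rewrite !exD; try by bm.
rewrite exN; last by bm.
rewrite !(uc_sg uU)// ex_cst /psi.
by field.
Qed.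

Lemma ex_sqr_sg_convol a : 0 <= a <= 1 -> E (fun q => sg_convol a (U q) ^+ 2) = 1 / 3.
Proof.
move=> a01; transitivity (E (fun q => 4 * psi a (U q) ^+ 2)).
  apply: (eq_ex_coord uU (s := [:: a])); [by rewrite /sg_convol; bm|by bm|move=> q].
  by rewrite inE eq_sym => aU; apply: sqr_sg_convol => //; exact: (uc_itv uU).
by rewrite exZl ?(ex_psi2 uU); [field| |bm].
Qed.

End one.

Variables X Y : T -> R.
Hypotheses (uX : uniform_coord P X) (uY : uniform_coord P Y).
Let bX := bmeas_coord uX.
Let bY := bmeas_coord uY.
Hypothesis indep : forall f g : R -> R, bmeas f -> bmeas g ->
  E (fun r => f (X r) * g (Y r)) = E (fun r => f (X r)) * E (fun r => g (Y r)).

Let bmeas_sgB (c : R) : bmeas (fun u : R => Num.sg (c - u)).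
Proof. by apply: measurable_bmeas_sg; exact: measurable_funB. Qed.

Let bmeas_Bsg (c : R) : bmeas (fun u : R => Num.sg (u - c)).
Proof. by apply: measurable_bmeas_sg; exact: measurable_funB. Qed.

Let measurable_coord2 U : uniform_coord P U ->
  measurable_fun setT (fun w : R * T => U w.2).
Proof. by move=> uU; apply: measurableT_comp (uc_meas uU) _. Qed.

Let bmeas_sg_convol U a : uniform_coord P U -> bmeas (sg_convol U a).
Proof.
move=> uU; have bU := bmeas_coord uU.
rewrite /sg_convol; apply: bmeas_ex; apply: bmeasM; first by bm.
apply: measurable_bmeas_sg; apply: measurable_funB => //.
exact: measurable_coord2.
Qed.

Lemma codegree_indep p q :
  codegree P X Y p q = sg_convol X (X p) (X q) * sg_convol Y (Y p) (Y q).
Proof.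
rewrite /codegree /sg_convol.
rewrite -(indep (f := fun u => Num.sg (X p - u) * Num.sg (u - X q))
  (g := fun u => Num.sg (Y p - u) * Num.sg (u - Y q))); [|exact: bmeasM|exact: bmeasM].
by apply: eq_ex => r; rewrite /concord; ring.
Qed.

(** The codegree factors, and so does the mean of its square over [q]; each coordinate contributes
    1/3, whatever [p] is. *)
Lemma ex2_codegree_indep : ex2 P (fun p q => codegree P X Y p q ^+ 2) = 1 / 9.
Proof.
rewrite -(ex_cst P (1 / 9)); apply: eq_ex => p.
transitivity (E (fun q => sg_convol X (X p) (X q) ^+ 2 * sg_convol Y (Y p) (Y q) ^+ 2)).
  by apply: eq_ex => q; rewrite codegree_indep exprMn.
rewrite (indep (f := fun u => sg_convol X (X p) u ^+ 2)
  (g := fun u => sg_convol Y (Y p) u ^+ 2)); [|exact/bmeasX/bmeas_sg_convol..].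
rewrite (ex_sqr_sg_convol uX) ?(ex_sqr_sg_convol uY); [by field| |];
  [exact: (uc_itv uY)|exact: (uc_itv uX)].
Qed.

Lemma ex2_concord_indep : ex2 P (concord X Y) = 0.
Proof.
transitivity (E (fun p => E (fun q => Num.sg (X p - X q)) * E (fun q => Num.sg (Y p - Y q)))).
  by apply: eq_ex => p;
    exact: (indep (f := fun u => Num.sg (X p - u)) (g := fun u => Num.sg (Y p - u))).
pose gX u := E (fun q => Num.sg (u - X q)); pose gY u := E (fun q => Num.sg (u - Y q)).
have bg U : uniform_coord P U -> bmeas (fun u : R => E (fun q => Num.sg (u - U q))).
  move=> uU; apply: bmeas_ex; apply: measurable_bmeas_sg.
  by apply: measurable_funB => //; exact: measurable_coord2.
rewrite (indep (f := gX) (g := gY)); [|exact: bg|exact: bg].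
suff -> : E (fun r => gX (X r)) = 0 by rewrite mul0r.
transitivity (E (fun r => 2 * X r - 1)).
  by apply: eq_ex => r; rewrite /gX (uc_sg uX)//; exact: (uc_itv uX).
rewrite exB ?exZl ?ex_cst ?(ex_coord uX); [by field|by bm..].
Qed.

End independent_coordinates.

(** * Occurrences of patterns as polynomials in concordances *)

Lemma incr_perm_eq1 n (s : 'S_n) :
  (forall i j : 'I_n, (i < j)%N -> (s i < s j)%N) -> s = 1%g.
Proof.
move=> s_incr.
(* Used for [s] and for its inverse, which gives both inequalities between [s i] and [i]. *)
have id_le (u : 'S_n) : (forall i j : 'I_n, (i < j)%N -> (u i < u j)%N) ->
    forall k (i : 'I_n), i = k :> nat -> (k <= u i)%N.
  move=> u_incr; elim=> // k IHk i ik.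
  have kn : (k < n)%N by rewrite -ltnS -ik ltnS ltnW.
  apply: (leq_ltn_trans (IHk (Ordinal kn) erefl)).
  by apply: u_incr; rewrite ik.
have sV_incr (i j : 'I_n) : (i < j)%N -> (s^-1%g i < s^-1%g j)%N.
  rewrite ltnNge => /negP ij; rewrite ltnNge; apply/negP => ji; apply: ij.
  move: ji; rewrite leq_eqVlt => /orP[/eqP/val_inj/perm_inj ->//|/s_incr].
  by rewrite !permKV => /ltnW.
apply/permP => i; rewrite perm1; apply/val_inj/eqP; rewrite eqn_leq.
have := id_le _ sV_incr _ (s i) erefl; rewrite permK => ->.
exact: id_le.
Qed.

Section concordance_polynomials.
Context {T : Type} {R : realType}.
Variable K : T -> T -> R.

Definition cherries p q r s := K p q * K p r + K p q * K p s + K p r * K p s.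
(** The factors are grouped by [r] and [s]: for fixed [p] and [q], opposite on the cycle, the mean
    is a square. *)
Definition cycle4 p q r s := K p r * K r q * (K p s * K s q).
(** For symmetric [K] with values 1 and -1, this is 1 if the three values agree, as for 123 and 321,
    and 0 otherwise. *)
Definition monotone3 p q r :=
  (1 + K p q * K p r + K q p * K q r + K r p * K r q) / 4.
(* For the graph whose edges are the pairs with [K = -1], this is 1 on a perfect
   matching (2143) and on a 4-cycle (3412), 1/2 on a path with 3 edges (2413 and
   3142), and 0 on all other graphs. *)
Definition graph4 p q r s :=
  3 / 16 + (K p q * K r s + K p r * K q s + K p s * K q r) / 8
  + (cycle4 p q r s + cycle4 p r q s + cycle4 p s q r) / 16
  - (cherries p q r s + cherries q p r s + cherries r p q s + cherries s p q r) / 16.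

End concordance_polynomials.

Section patterns.
Context {R : realType}.
Local Notation T := (plane R).
Implicit Types (p q r s : T).

(** Reordering the sample only composes the relabelling with [sigma]; this allows a reduction to
    samples listed by increasing abscissa. *)
Lemma pattern_event_perm n (pi sigma : 'S_n) (t : n.-tuple T) :
  pattern_event pi [tuple tnth t (sigma i) | i < n] <-> pattern_event pi t.
Proof.
split=> -[s [xs ys]].
  exists (s * sigma)%g; split => i j; rewrite !permM.
    by move=> /xs; rewrite !tnth_mktuple.
  by have := ys i j; rewrite !tnth_mktuple.
exists (s * sigma^-1)%g; split => i j; rewrite !permM !tnth_mktuple !permKV.
  exact: xs.
exact: ys.
Qed.

(** Increasing abscissas leave the identity as the only relabelling, and for distinct ordinates the
    comparisons with [i < j] determine the others. *)
Lemma pattern_event_sorted n w (wP : perm_eq w (iota 1 n)) (t : n.-tuple T) :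
  (forall i j : 'I_n, (i < j)%N -> xcoord (tnth t i) < xcoord (tnth t j)) ->
  (forall i j : 'I_n, (i < j)%N -> ycoord (tnth t i) != ycoord (tnth t j)) ->
  pattern_event (perm_of_word wP) t <->
  forall i j : 'I_n, (i < j)%N ->
    (ycoord (tnth t i) < ycoord (tnth t j)) = (nth 0 w i < nth 0 w j)%N.
Proof.
move=> x_incr y_neq.
have piE (i j : 'I_n) :
    (perm_of_word wP i < perm_of_word wP j)%N = (nth 0 w i < nth 0 w j)%N.
  by rewrite -!(perm_of_wordE wP) ltnS.
split=> [[s [xs ys]] i j ij|yE].
  have s1 : s = 1%g.
    apply: incr_perm_eq1 => k l kl; rewrite ltnNge; apply/negP => ji.
    have := xs _ _ kl; rewrite ltNge => /negP; apply.
    move: ji; rewrite leq_eqVlt => /orP[/eqP/val_inj ->//|/x_incr/ltW//].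
  have := ys i j; rewrite s1 !perm1 piE => yij.
  by apply/idP/idP => /yij.
exists 1%g; split=> i j; rewrite !perm1; first exact: x_incr.
rewrite piE; have [ij|ji|ij] := ltngtP i j.
- by rewrite yE.
- have := yE _ _ ji; have := y_neq _ _ ji.
  have : nth 0%N w i != nth 0%N w j.
    apply/negP => /eqP; rewrite -!(perm_of_wordE wP) => -[] /val_inj/perm_inj ij.
    by rewrite ij ltnn in ji.
  move=> nw ny yji; rewrite ltNge le_eqVlt (negbTE ny) yji /=.
  by rewrite -leqNgt ltn_neqAle nw.
- by rewrite (val_inj ij) ltnn ltxx.
Qed.

Definition tuple3 p q r : 3.-tuple T :=
  tuple_cons (p, tuple_cons (q, tuple_cons (r, [tuple]))).
Definition tuple4 p q r s : 4.-tuple T := tuple_cons (p, tuple3 q r s).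

Definition concordance p q : R :=
  Num.sg (xcoord p - xcoord q) * Num.sg (ycoord p - ycoord q).
Local Notation K := concordance.

Definition occurs3 w (wP : perm_eq w (iota 1 3)) p q r : R :=
  \1_(pattern_event (perm_of_word wP)) (tuple3 p q r).
Definition occurs4 w (wP : perm_eq w (iota 1 4)) p q r s : R :=
  \1_(pattern_event (perm_of_word wP)) (tuple4 p q r s).

Lemma indic_iff X (A : set X) (B : set X) a b : (A a <-> B b) ->
  \1_A a = \1_B b :> R.
Proof.
by move=> ab; rewrite !indicE; congr (nat_of_bool _)%:R; apply/idP/idP;
  rewrite !inE => /ab.
Qed.

Lemma occurs_swap n (pi : 'S_n) (t u : n.-tuple T) (i j : 'I_n) :
  u = [tuple tnth t (tperm i j k) | k < n] ->
  \1_(pattern_event pi) u = \1_(pattern_event pi) t :> R.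
Proof. by move=> ->; apply: indic_iff; exact: pattern_event_perm. Qed.

Ltac swap_tuple n a b :=
  apply: (@occurs_swap n _ _ _ (@Ordinal n a isT) (@Ordinal n b isT));
  apply: eq_from_tnth => -[[|[|[|[|]]]] ?//];
  rewrite tnth_mktuple !(tnth_nth (point : T)) permE /=.

Lemma occurs3_swap12 w wP p q r : @occurs3 w wP q p r = occurs3 wP p q r.
Proof. by swap_tuple 3%N 0%N 1%N. Qed.
Lemma occurs3_swap23 w wP p q r : @occurs3 w wP p r q = occurs3 wP p q r.
Proof. by swap_tuple 3%N 1%N 2%N. Qed.
Lemma occurs4_swap12 w wP p q r s : @occurs4 w wP q p r s = occurs4 wP p q r s.
Proof. by swap_tuple 4%N 0%N 1%N. Qed.
Lemma occurs4_swap23 w wP p q r s : @occurs4 w wP p r q s = occurs4 wP p q r s.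
Proof. by swap_tuple 4%N 1%N 2%N. Qed.
Lemma occurs4_swap34 w wP p q r s : @occurs4 w wP p q s r = occurs4 wP p q r s.
Proof. by swap_tuple 4%N 2%N 3%N. Qed.

Lemma indic_bool X (A : set X) a (b : bool) : (A a <-> b) -> \1_A a = b%:R :> R.
Proof.
by move=> ab; rewrite indicE; congr (nat_of_bool _)%:R; apply/idP/idP;
  rewrite inE => /ab.
Qed.

Lemma occurs3_sorted w (wP : perm_eq w (iota 1 3)) p q r :
  xcoord p < xcoord q < xcoord r ->
  ycoord p != ycoord q -> ycoord p != ycoord r -> ycoord q != ycoord r ->
  occurs3 wP p q r =
    [&& (ycoord p < ycoord q) == (nth 0 w 0 < nth 0 w 1)%N,
        (ycoord p < ycoord r) == (nth 0 w 0 < nth 0 w 2)%N &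
        (ycoord q < ycoord r) == (nth 0 w 1 < nth 0 w 2)%N]%:R.
Proof.
move=> /andP[pq qr] ypq ypr yqr; have pr := lt_trans pq qr.
apply: indic_bool.
have tE k (i : 'I_3) : i = k :> nat -> tnth (tuple3 p q r) i = nth p [:: p; q; r] k.
  by move=> <-; rewrite (tnth_nth p).
apply: iff_trans (pattern_event_sorted _ _ _) _ => [i j|i j|].
- by rewrite (tE i)// (tE j)//; case: i j => -[|[|[|]]] // ? [[|[|[|]]]].
- by rewrite (tE i)// (tE j)//; case: i j => -[|[|[|]]] // ? [[|[|[|]]]].
split=> [yE|/and3P[/eqP y01 /eqP y02 /eqP y12] i j].
  pose o k (h : (k < 3)%N) := Ordinal h.
  have := yE (o 0%N isT) (o 1%N isT) isT; have := yE (o 0%N isT) (o 2%N isT) isT.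
  have := yE (o 1%N isT) (o 2%N isT) isT.
  rewrite (tE 0%N (o 0%N isT))// (tE 1%N (o 1%N isT))// (tE 2%N (o 2%N isT))//=.
  by move=> -> -> ->; rewrite !eqxx.
by rewrite (tE i)// (tE j)//; case: i j => -[|[|[|]]] // ? [[|[|[|]]]].
Qed.

Lemma occurs4_sorted w (wP : perm_eq w (iota 1 4)) p q r s :
  [&& xcoord p < xcoord q, xcoord q < xcoord r & xcoord r < xcoord s] ->
  ycoord p != ycoord q -> ycoord p != ycoord r -> ycoord p != ycoord s ->
  ycoord q != ycoord r -> ycoord q != ycoord s -> ycoord r != ycoord s ->
  occurs4 wP p q r s =
    [&& (ycoord p < ycoord q) == (nth 0 w 0 < nth 0 w 1)%N,
        (ycoord p < ycoord r) == (nth 0 w 0 < nth 0 w 2)%N,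
        (ycoord p < ycoord s) == (nth 0 w 0 < nth 0 w 3)%N,
        (ycoord q < ycoord r) == (nth 0 w 1 < nth 0 w 2)%N,
        (ycoord q < ycoord s) == (nth 0 w 1 < nth 0 w 3)%N &
        (ycoord r < ycoord s) == (nth 0 w 2 < nth 0 w 3)%N]%:R.
Proof.
move=> /and3P[pq qr rs] ypq ypr yps yqr yqs yrs.
have pr := lt_trans pq qr; have qs := lt_trans qr rs; have ps := lt_trans pr rs.
apply: indic_bool.
have tE k (i : 'I_4) : i = k :> nat ->
    tnth (tuple4 p q r s) i = nth p [:: p; q; r; s] k.
  by move=> <-; rewrite (tnth_nth p).
apply: iff_trans (pattern_event_sorted _ _ _) _ => [i j|i j|].
- by rewrite (tE i)// (tE j)//; case: i j => -[|[|[|[|]]]] // ? [[|[|[|[|]]]]].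
- by rewrite (tE i)// (tE j)//; case: i j => -[|[|[|[|]]]] // ? [[|[|[|[|]]]]].
split=> [yE|/and5P[/eqP y01 /eqP y02 /eqP y03 /eqP y12
  /andP[/eqP y13 /eqP y23]] i j].
  pose o k (h : (k < 4)%N) := Ordinal h.
  have := yE (o 0%N isT) (o 1%N isT) isT; have := yE (o 0%N isT) (o 2%N isT) isT.
  have := yE (o 0%N isT) (o 3%N isT) isT; have := yE (o 1%N isT) (o 2%N isT) isT.
  have := yE (o 1%N isT) (o 3%N isT) isT; have := yE (o 2%N isT) (o 3%N isT) isT.
  rewrite (tE 0%N (o 0%N isT))// (tE 1%N (o 1%N isT))// (tE 2%N (o 2%N isT))//.
  rewrite (tE 3%N (o 3%N isT))//=.
  by move=> -> -> -> -> -> ->; rewrite !eqxx.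
by rewrite (tE i)// (tE j)//; case: i j => -[|[|[|[|]]]] // ? [[|[|[|[|]]]]].
Qed.

Lemma concordanceC p q : K p q = K q p.
Proof.
rewrite /concordance -opprB sgrN -(opprB (ycoord q)) sgrN.
by rewrite mulrNN.
Qed.

Lemma concordance_sorted p q : xcoord p < xcoord q -> ycoord p != ycoord q ->
  K p q = if ycoord p < ycoord q then 1 else -1.
Proof.
move=> xpq ypq; rewrite /concordance ltr0_sg ?subr_lt0//.
case: ltgtP ypq => // ypq _.
  by rewrite ltr0_sg ?subr_lt0//; ring.
by rewrite gtr0_sg ?subr_gt0//; ring.
Qed.

Definition w123 : perm_eq [:: 1; 2; 3]%N (iota 1 3) := isT.
Definition w321 : perm_eq [:: 3; 2; 1]%N (iota 1 3) := isT.
Definition w2143 : perm_eq [:: 2; 1; 4; 3]%N (iota 1 4) := isT.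
Definition w3412 : perm_eq [:: 3; 4; 1; 2]%N (iota 1 4) := isT.
Definition w2413 : perm_eq [:: 2; 4; 1; 3]%N (iota 1 4) := isT.
Definition w3142 : perm_eq [:: 3; 1; 4; 2]%N (iota 1 4) := isT.

Let sb (b : bool) : R := if b then 1 else -1.
(** Transitivity for the comparisons of points 1 and 2, 2 and 3, 1 and 3; it excludes the truth
    values that no linear order realises. *)
Let tri (a b c : bool) := (a && b ==> c) && (~~ a && ~~ b ==> ~~ c).

Let tri_lt (a b c : R) : a != b -> b != c -> a != c ->
  tri (a < b) (b < c) (a < c).
Proof.
rewrite /tri; case: (ltgtP a b) => // ab _; case: (ltgtP b c) => // bc _ ac /=.
- by rewrite (lt_trans ab bc).
- by rewrite -leNgt ltW// (lt_trans bc ab).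
Qed.

Let bool3 (a b c : bool) : tri a c b ->
  [&& a == true, b == true & c == true]%:R +
  [&& a == false, b == false & c == false]%:R =
  (1 + sb a * sb b + sb a * sb c + sb b * sb c) / 4.
Proof. by case: a; case: b; case: c => //= _; rewrite /sb; field. Qed.

(** A finite check: [a] to [f] compare the ordinates of the pairs 12, 13, 14, 23, 24, 34, the
    hypotheses are transitivity on the four triples, and the rows encode 2143, 3412, 2413, 3142. *)
Let bool4 (a b c d e f : bool) :
  tri a d b -> tri a e c -> tri b f c -> tri d f e ->
  [&& a == false, b == true, c == true, d == true, e == true & f == false]%:R +
  [&& a == true, b == false, c == false, d == false, e == false & f == true]%:R +
  ([&& a == true, b == false, c == true, d == false, e == false & f == true]%:R +
   [&& a == false, b == true, c == false, d == true, e == true & f == false]%:R) / 2 =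
  3 / 16 + (sb a * sb f + sb b * sb e + sb c * sb d) / 8
  + (sb b * sb d * (sb c * sb e) + sb a * sb d * (sb c * sb f)
     + sb a * sb e * (sb b * sb f)) / 16
  - (sb a * sb b + sb a * sb c + sb b * sb c
     + (sb a * sb d + sb a * sb e + sb d * sb e)
     + (sb b * sb d + sb b * sb f + sb d * sb f)
     + (sb c * sb e + sb c * sb f + sb e * sb f)) / 16.
Proof.
by case: a; case: b; case: c; case: d; case: e; case: f => //= _ _ _ _;
  rewrite /sb; field.
Qed.

Definition generic (l : seq T) := uniq (map xcoord l) && uniq (map ycoord l).

Let good3 p q r := generic [:: p; q; r] ->
  occurs3 w123 p q r + occurs3 w321 p q r = monotone3 K p q r.

Let good3_swap12 p q r : good3 p q r -> good3 q p r.
Proof.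
move=> g pqr; rewrite !(occurs3_swap12 _ p q r) g.
  by rewrite /monotone3 ?(concordanceC q p) ?(concordanceC r p) ?(concordanceC r q); ring.
move: pqr; rewrite /generic /= !inE !negb_or [xcoord q == xcoord p]eq_sym.
by rewrite [ycoord q == ycoord p]eq_sym; case/andP=> /and3P[/andP[-> ->] -> _]
  /and3P[/andP[-> ->] -> _].
Qed.

Let good3_swap23 p q r : good3 p q r -> good3 p r q.
Proof.
move=> g pqr; rewrite !(occurs3_swap23 _ p q r) g.
  by rewrite /monotone3 ?(concordanceC q p) ?(concordanceC r p) ?(concordanceC r q); ring.
move: pqr; rewrite /generic /= !inE !negb_or [xcoord r == xcoord q]eq_sym.
by rewrite [ycoord r == ycoord q]eq_sym; case/andP=> /and3P[/andP[-> ->] -> _]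
  /and3P[/andP[-> ->] -> _].
Qed.

Let good3_sorted p q r : xcoord p < xcoord q < xcoord r -> good3 p q r.
Proof.
move=> xs /andP[_]; rewrite /= !inE negb_or => /and3P[/andP[pq pr] qr _].
have /andP[xpq xqr] := xs; have xpr := lt_trans xpq xqr.
rewrite !occurs3_sorted//= bool3; last exact: tri_lt.
rewrite /monotone3 (concordanceC q p) (concordanceC r p) (concordanceC r q).
by rewrite !concordance_sorted.
Qed.

(** Both sides are symmetric in the points, so an insertion sort by adjacent swaps reduces to
    increasing abscissas. The case of four points is the same. *)
Lemma occurs3_monotone p q r : good3 p q r.
Proof.
have g2 a b c : xcoord b < xcoord c -> good3 a b c.
  move=> bc gabc; have /andP[/=] := gabc.
  rewrite !inE negb_or => /and3P[/andP[ab ac] _ _] _; move: gabc.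
  case: (ltgtP (xcoord a) (xcoord b)) ab => // ab _.
    by apply: good3_sorted; rewrite ab bc.
  case: (ltgtP (xcoord a) (xcoord c)) ac => // ac _; apply: good3_swap12.
    by apply: good3_sorted; rewrite ab ac.
  by apply: good3_swap23; apply: good3_sorted; rewrite bc ac.
move=> gpqr; have /andP[/=] := gpqr.
rewrite !inE => /and3P[_ qr _] _; move: gpqr.
case: (ltgtP (xcoord q) (xcoord r)) qr => // qr _; first exact: g2.
by apply: good3_swap23; exact: g2.
Qed.

Let good4 p q r s := generic [:: p; q; r; s] ->
  occurs4 w2143 p q r s + occurs4 w3412 p q r s +
  (occurs4 w2413 p q r s + occurs4 w3142 p q r s) / 2 = graph4 K p q r s.

Let good4_swap12 p q r s : good4 p q r s -> good4 q p r s.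
Proof.
move=> g pqr; rewrite !(occurs4_swap12 _ p q r s) g.
  by rewrite /graph4 /cycle4 /cherries ?(concordanceC q p) ?(concordanceC r p)
    ?(concordanceC r q) ?(concordanceC s p) ?(concordanceC s q) ?(concordanceC s r); ring.
move: pqr; rewrite /generic /= !inE !negb_or [xcoord q == xcoord p]eq_sym.
by rewrite [ycoord q == ycoord p]eq_sym;
  case/andP=> /and4P[/and3P[-> -> ->] /andP[-> ->] -> _]
  /and4P[/and3P[-> -> ->] /andP[-> ->] -> _].
Qed.

Let good4_swap23 p q r s : good4 p q r s -> good4 p r q s.
Proof.
move=> g pqr; rewrite !(occurs4_swap23 _ p q r s) g.
  by rewrite /graph4 /cycle4 /cherries ?(concordanceC q p) ?(concordanceC r p)
    ?(concordanceC r q) ?(concordanceC s p) ?(concordanceC s q) ?(concordanceC s r); ring.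
move: pqr; rewrite /generic /= !inE !negb_or [xcoord r == xcoord q]eq_sym.
by rewrite [ycoord r == ycoord q]eq_sym;
  case/andP=> /and4P[/and3P[-> -> ->] /andP[-> ->] -> _]
  /and4P[/and3P[-> -> ->] /andP[-> ->] -> _].
Qed.

Let good4_swap34 p q r s : good4 p q r s -> good4 p q s r.
Proof.
move=> g pqr; rewrite !(occurs4_swap34 _ p q r s) g.
  by rewrite /graph4 /cycle4 /cherries ?(concordanceC q p) ?(concordanceC r p)
    ?(concordanceC r q) ?(concordanceC s p) ?(concordanceC s q) ?(concordanceC s r); ring.
move: pqr; rewrite /generic /= !inE !negb_or [xcoord s == xcoord r]eq_sym.
by rewrite [ycoord s == ycoord r]eq_sym;
  case/andP=> /and4P[/and3P[-> -> ->] /andP[-> ->] -> _]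
  /and4P[/and3P[-> -> ->] /andP[-> ->] -> _].
Qed.

Let good4_sorted p q r s : xcoord p < xcoord q -> xcoord q < xcoord r ->
  xcoord r < xcoord s -> good4 p q r s.
Proof.
move=> xpq xqr xrs /andP[_]; rewrite /= !inE !negb_or.
move=> /and4P[/and3P[pq pr ps] /andP[qr qs] rs _].
have xpr := lt_trans xpq xqr; have xqs := lt_trans xqr xrs.
have xps := lt_trans xpq xqs.
have xs : [&& xcoord p < xcoord q, xcoord q < xcoord r & xcoord r < xcoord s].
  by rewrite xpq xqr xrs.
rewrite !(occurs4_sorted _ xs)//= bool4; try exact: tri_lt.
rewrite /graph4 /cycle4 /cherries (concordanceC q p) (concordanceC r p)
  (concordanceC r q) (concordanceC s p) (concordanceC s q) (concordanceC s r).
by rewrite !concordance_sorted.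
Qed.

Lemma occurs4_graph p q r s : good4 p q r s.
Proof.
have g3 a b c e : xcoord b < xcoord c -> xcoord c < xcoord e -> good4 a b c e.
  move=> bc ce gabc; have /andP[/=] := gabc.
  rewrite !inE !negb_or => /and4P[/and3P[ab ac ae] _ _ _] _; move: gabc.
  case: (ltgtP (xcoord a) (xcoord b)) ab => // ab _; first exact: good4_sorted.
  case: (ltgtP (xcoord a) (xcoord c)) ac => // ac _; apply: good4_swap12.
    exact: good4_sorted.
  case: (ltgtP (xcoord a) (xcoord e)) ae => // ae _; apply: good4_swap23.
    exact: good4_sorted.
  by apply: good4_swap34; exact: good4_sorted.
have g2 a b c e : xcoord c < xcoord e -> good4 a b c e.
  move=> ce gabc; have /andP[/=] := gabc.
  rewrite !inE !negb_or => /and4P[_ /andP[bc be] _ _] _; move: gabc.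
  case: (ltgtP (xcoord b) (xcoord c)) bc => // bc _; first exact: g3.
  case: (ltgtP (xcoord b) (xcoord e)) be => // be _; apply: good4_swap23.
    exact: g3.
  by apply: good4_swap34; exact: g3.
move=> gpqr; have /andP[/=] := gpqr.
rewrite !inE => /and4P[_ _ rs _] _; move: gpqr.
case: (ltgtP (xcoord r) (xcoord s)) rs => // rs _; first exact: g2.
by apply: good4_swap34; exact: g2.
Qed.

End patterns.

(** * Expectations over four independent points *)

Section four_points.
Context {d : measure_display} {T : measurableType d} {R : realType}.
Variable P : probability T R.
Local Notation E := (ex P).
Implicit Types F G : T -> T -> T -> T -> R.

Definition ex4 F := ex2 P (fun p q => ex2 P (F p q)).

Definition bmeas4 F := bmeas (fun w : T * T * T * T => F w.1.1.1 w.1.1.2 w.1.2 w.2).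

Lemma bmeas4_comp F d' (Z : measurableType d') (f g h k : Z -> T) : bmeas4 F ->
  measurable_fun setT f -> measurable_fun setT g ->
  measurable_fun setT h -> measurable_fun setT k ->
  bmeas (fun z => F (f z) (g z) (h z) (k z)).
Proof.
move=> bF mf mg mh mk.
apply: (bmeas_comp (g := fun z => (f z, g z, h z, k z)) bF).
by do 3 ?[apply: measurable_fun_pair => //].
Qed.

Lemma bmeas4D F G : bmeas4 F -> bmeas4 G ->
  bmeas4 (fun p q r s => F p q r s + G p q r s).
Proof. exact: bmeasD. Qed.

Lemma bmeas4Z c F : bmeas4 F -> bmeas4 (fun p q r s => c * F p q r s).
Proof. by move=> bF; apply: bmeasM bF; exact: bmeas_cst. Qed.

Ltac bm4 := apply: bmeas4_comp => //; by measurable_proj.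

Lemma eq_ex4 F G : (forall p q r s, F p q r s = G p q r s) -> ex4 F = ex4 G.
Proof. by move=> FG; do 2 (apply: eq_ex2 => ? ?). Qed.

Lemma ex4D F G : bmeas4 F -> bmeas4 G ->
  ex4 (fun p q r s => F p q r s + G p q r s) = ex4 F + ex4 G.
Proof.
move=> bF bG; rewrite /ex4 -ex2D; [|do 2 apply: bmeas_ex; bm4..].
by apply: eq_ex2 => p q; rewrite ex2D//; bm4.
Qed.

Lemma ex4Z c F : bmeas4 F -> ex4 (fun p q r s => c * F p q r s) = c * ex4 F.
Proof.
move=> bF; rewrite /ex4 -ex2Z; [|do 2 apply: bmeas_ex; bm4].
by apply: eq_ex2 => p q; rewrite ex2Z//; bm4.
Qed.

Lemma ex4_cst c : ex4 (fun _ _ _ _ => c) = c.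
Proof. by rewrite /ex4 -[RHS](ex2_cst P); apply: eq_ex2 => p q; rewrite ex2_cst. Qed.

Lemma ex4_swap12 F : bmeas4 F -> ex4 F = ex4 (fun p q r s => F q p r s).
Proof. by move=> bF; rewrite /ex4 ex2_swap//; do 2 apply: bmeas_ex; bm4. Qed.

Lemma ex4_swap34 F : bmeas4 F -> ex4 F = ex4 (fun p q r s => F p q s r).
Proof. by move=> bF; apply: eq_ex2 => p q; rewrite ex2_swap//; bm4. Qed.

Lemma ex4_swap23 F : bmeas4 F -> ex4 F = ex4 (fun p q r s => F p r q s).
Proof.
move=> bF; apply: eq_ex => p; rewrite [LHS]ex_swap//.
by apply: bmeas_ex; bm4.
Qed.

End four_points.

(** * Drawing a sample point by point *)

Section sampling.
Context {d : measure_display} {T : measurableType d} {R : realType}.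
Variable P : probability T R.

Lemma power_measureS n (A : set (n.+1.-tuple T)) : measurable A ->
  fine (power_measure P n.+1 A) =
  ex P (fun p => fine (power_measure P n [set t | A (tuple_cons (p, t))])).
Proof.
move=> mA; rewrite /ex /Rintegral; congr fine.
rewrite /= /distribution /pushforward /product_measure1.
apply: eq_integral => p _ /=.
have -> : xsection (@tuple_cons _ _ _ @^-1` A) p = [set t | A (tuple_cons (p, t))].
  by apply/seteqP; split => t; rewrite /xsection/= inE.
rewrite fineK// fin_num_measure//.
rewrite -[X in measurable X]setTI.
apply: (measurableT_comp (@measurable_tuple_cons _ T n) (pair1_measurable p)) => //.
Qed.

End sampling.

(** * The coordinates of a permuton *)

Section permuton_coordinates.
Context {R : realType}.
Local Notation T := (plane R).
Variable mu : probability T R.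
Local Notation E := (ex mu).
Local Notation I := (@unit_itv R).

(** Clamped coordinates lie in [0,1] at every point of the plane, as [uc_itv] demands, and are the
    true ones on the unit square, which has full measure. *)
Definition clamp (u : R) : R := Order.max 0 (Order.min 1 u).

Lemma clamp_itv u : 0 <= clamp u <= 1.
Proof. by rewrite /clamp le_max lexx /= ge_max ler01 ge_min lexx. Qed.

Lemma clamp_id u : I u -> clamp u = u.
Proof.
rewrite /unit_itv/= in_itv/= => /andP[u0 u1].
by rewrite /clamp (min_idPr u1) (max_idPr u0).
Qed.

Hypothesis mu_permuton : is_permuton mu.

Lemma measurable_unit_itv : measurable (I : set R).
Proof. exact: measurable_itv. Qed.

Lemma measurable_square : measurable (I `*` I : set T).
Proof. by apply: measurableX; exact: measurable_unit_itv. Qed.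

Lemma measurable_squareC : measurable (~` (I `*` I) : set T).
Proof. by apply: measurableC; exact: measurable_square. Qed.

Lemma square_null : mu (~` (I `*` I)) = 0%E.
Proof.
have [+ _] := mu_permuton measurable_unit_itv (@subset_refl _ _).
rewrite lebesgue_measure_itv /= lte_fin ltr01 oppr0 adde0 => mu1.
by rewrite probability_setC ?mu1 ?subee//; exact: measurable_square.
Qed.

Lemma uniform_coord_clamp (f : T -> R) : measurable_fun setT f ->
  (forall p, (I `*` I) p -> I (f p)) ->
  (forall A : set R, measurable A -> A `<=` I ->
    mu (f @^-1` A `&` (I `*` I)) = lebesgue_measure A) ->
  uniform_coord mu (fun p => clamp (f p)).
Proof.
move=> mf fI fmu.
have mcf : measurable_fun setT (fun p => clamp (f p)).
  by apply: measurable_maxr => //; exact: measurable_minr.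
have mfib c : measurable [set p | clamp (f p) = c].
  by rewrite -[X in measurable X]setTI; exact: (mcf measurableT _ (measurable_set1 c)).
(* Inside the square the fibre lies over a single point, which is Lebesgue null. *)
have fib0 c : mu [set p | clamp (f p) = c] = 0%E.
  apply/eqP; rewrite eq_le measure_ge0 andbT.
  have mcI : measurable ([set c] `&` I : set R).
    by apply: measurableI; [exact: measurable_set1|exact: measurable_unit_itv].
  have mfc : measurable (f @^-1` ([set c] `&` I) `&` (I `*` I)).
    apply: measurableI measurable_square.
    by rewrite -[X in measurable X]setTI; exact: mf.
  apply: (@le_trans _ _
    (mu (f @^-1` ([set c] `&` I) `&` (I `*` I) `|` ~` (I `*` I)))).
    apply: le_measure; rewrite ?inE//.
      by apply: measurableU => //; exact: measurable_squareC.
    move=> p /= <-; have [Ip|nIp] := pselect ((I `*` I) p); last by right.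
    by left; split=> //; rewrite clamp_id//; [split => //; exact: fI|exact: fI].
  rewrite measureU0//; [|exact: measurable_squareC|exact: square_null].
  apply: (@le_trans _ _ (lebesgue_measure ([set c] `&` I))).
    by rewrite -(fmu _ mcI)//; exact: lexx.
  apply: (@le_trans _ _ (lebesgue_measure [set c])).
    by apply: le_measure; rewrite ?inE//; exact: measurable_set1.
  by rewrite lebesgue_measure_set1.
split=> // [p|c c01]; first exact: clamp_itv.
have mIc : measurable (`[0, c[%classic : set R) by exact: measurable_itv.
have IcI : `[0, c[%classic `<=` I.
  move=> u; rewrite /unit_itv /= !in_itv/= => /andP[-> uc].
  by have /andP[_ c1] := c01; rewrite (le_trans (ltW uc)).
pose A := f @^-1` `[0, c[%classic `&` (I `*` I).
have mA : measurable A.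
  apply: measurableI measurable_square.
  by rewrite -[X in measurable X]setTI; exact: mf.
have bA : bmeas (\1_A : T -> R) by exact: bmeas_ind.
(* Inside the square and off the fibre of [c], the sign is 1 on [A] and -1 elsewhere. *)
transitivity (E (fun r => 2 * \1_A r - 1)).
  apply: (@eq_ex_null _ _ _ _ (~` (I `*` I) `|` [set p | clamp (f p) = c])) => //.
  - by apply: measurableU => //; exact: measurable_squareC.
  - rewrite measureU0; [exact: square_null|exact: measurable_squareC
      |exact: mfib|exact: fib0].
  - by apply: measurable_bmeas_sg; exact: measurable_funB.
  - by bm.
  move=> r /not_orP[/contrapT Ir]; have Ifr := fI _ Ir; rewrite /= clamp_id// => frc.
  move: (Ifr); rewrite /unit_itv /= in_itv /= => /andP[fr0 fr1].
  rewrite indicE; have [cf|fc] := leP c (f r).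
    have -> : (r \in A) = false.
      by apply/negbTE/negP; rewrite inE /A /= => -[+ _];
        rewrite in_itv/= ltNge cf andbF.
    rewrite ltr0_sg ?mulr0 ?sub0r// subr_lt0 lt_neqAle cf andbT.
    by apply/eqP => cfr; apply: frc.
  rewrite mem_set; last by split => //=; rewrite in_itv/= fr0.
  rewrite gtr0_sg ?subr_gt0//.
  by have -> : true%:R = 1 :> R by []; ring.
rewrite exB ?exZl ?ex_cst; [|by bm..].
rewrite ex_indic// (_ : mu A = lebesgue_measure (`[0, c[%classic : set R)); last first.
  exact: fmu.
rewrite lebesgue_measure_itv /= lte_fin.
have /andP[c0 _] := c01; move: c0; rewrite le_eqVlt => /orP[/eqP <-|c0].
  by rewrite ltxx /=.
by rewrite c0 -EFinB /= subr0.
Qed.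

Definition cx (p : T) := clamp (xcoord p).
Definition cy (p : T) := clamp (ycoord p).

Lemma uniform_cx : uniform_coord mu cx.
Proof.
apply: uniform_coord_clamp; [exact: measurable_fst|by move=> p []|].
move=> A mA AI; have [<- _] := mu_permuton mA AI; congr (mu _).
by apply/seteqP; split => [p [Ap []]|p [Ap Ip]] //; split => //; split => //; exact: AI.
Qed.

Lemma uniform_cy : uniform_coord mu cy.
Proof.
apply: uniform_coord_clamp; [exact: measurable_snd|by move=> p []|].
move=> A mA AI; have [_ <-] := mu_permuton mA AI; congr (mu _).
by apply/seteqP; split => [p [Ap []]|p [Ip Ap]] //; split => //; split => //; exact: AI.
Qed.

End permuton_coordinates.

(** * Measures determined by quadrants *)

Section uniqueness.
Context {R : realType}.
Local Notation mR := (measurableTypeR R).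
Local Notation T := (plane R).
Local Notation ray a := (`]-oo, a[%classic : set mR).

(** Rays are closed under intersection, generate the Borel sets and exhaust the line. *)
Lemma eq_measure_rays (m1 m2 : {measure set mR -> \bar R}) :
  (forall a, m1 (ray a) = m2 (ray a)) -> (forall a, (m1 (ray a) < +oo)%E) ->
  forall A, measurable A -> m1 A = m2 A.
Proof.
move=> m12 m1oo A mA; refine (@measure_unique _ R mR (@RGenInftyO.G R)
  (fun k : nat => ray k%:R) _ _ _ _ m1 m2 _ _ A mA).
- exact: RGenInftyO.measurableE.
- move=> _ _ [a ->] [b ->]; exists (Order.min a b).
  apply/seteqP; split => u /=; rewrite !in_itv/= lt_min.
    by move=> [-> ->].
  by move=> /andP[].
- by move=> k; exists k%:R.
- apply/seteqP; split => // u _; exists (Num.truncn `|u|).+1 => //=.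
  rewrite in_itv/= (le_lt_trans (ler_norm u))//.
  exact: truncnS_gt.
- by move=> _ [a ->]; exact: m12.
- by move=> k; exact: m1oo.
Qed.

(** One side is freed at a time: with the other side fixed, both measures push forward to the line,
    where rays suffice. *)
Lemma eq_measure_quadrants (m1 m2 : {measure set T -> \bar R}) :
  (m1 setT < +oo)%E -> (forall a b, m1 (ray a `*` ray b) = m2 (ray a `*` ray b)) ->
  forall A B, measurable A -> measurable B -> m1 (A `*` B) = m2 (A `*` B).
Proof.
move=> m1oo m12.
have fin (C : set T) : measurable C -> (m1 C < +oo)%E.
  by move=> mC; apply: le_lt_trans m1oo; apply: le_measure; rewrite ?inE.
have mTB (B : set mR) : measurable B -> measurable (setT `*` B : set T).
  by move=> mB; exact: measurableX.
have mAT (A : set mR) : measurable A -> measurable (A `*` setT : set T).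
  by move=> mA; exact: measurableX.
have rayE b : measurable (ray b) by exact: measurable_itv.
have step1 b A : measurable A -> m1 (A `*` ray b) = m2 (A `*` ray b).
  move=> mA.
  pose n0 (m : {measure set T -> \bar R}) : {measure set mR -> \bar R} :=
    pushforward (mrestr m (mTB _ (rayE b))) (fst : T -> mR).
  pose n := n0 measurable_fst.
  have nE m C : n m C = m (C `*` ray b).
    rewrite /n /n0 /= /pushforward /mrestr; congr (m _).
    by apply/seteqP; split => [p [? []]|p []].
  rewrite -!nE; apply: eq_measure_rays => // a; rewrite !nE; first exact: m12.
  by apply: fin; exact: measurableX.
move=> A B mA mB.
pose n0 (m : {measure set T -> \bar R}) : {measure set mR -> \bar R} :=
  pushforward (mrestr m (mAT _ mA)) (snd : T -> mR).
pose n := n0 measurable_snd.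
have nE m C : n m C = m (A `*` C).
  rewrite /n /n0 /= /pushforward /mrestr; congr (m _).
  by apply/seteqP; split => [p [? []]|p []].
rewrite -!nE; apply: eq_measure_rays => // a; rewrite !nE; first exact: step1.
by apply: fin; exact: measurableX.
Qed.

End uniqueness.

(** * Uniformity as independence of the marginals *)

Section marginals.
Context {R : realType}.
Local Notation mR := (measurableTypeR R).
Local Notation T := (plane R).
Local Notation I := (@unit_itv R).
Local Notation ray a := (`]-oo, a[%classic : set mR).
Local Notation leb := (@lebesgue_measure R).

HB.instance Definition _ :=
  @isMeasurableFun.Build _ _ T mR (fst : T -> mR) measurable_fst.
HB.instance Definition _ :=
  @isMeasurableFun.Build _ _ T mR (snd : T -> mR) measurable_snd.

Variable mu : probability T R.
Hypothesis mu_permuton : is_permuton mu.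

Definition xlaw : probability mR R := distribution mu (fst : T -> mR).
Definition ylaw : probability mR R := distribution mu (snd : T -> mR).

Lemma mu_square (A : set T) : measurable A -> mu A = mu (A `&` (I `*` I)).
Proof.
move=> mA; have mI := @measurable_square R; have mIC := @measurable_squareC R.
rewrite -[in LHS](setIT A) -(setUv (I `*` I)) setIUr measureU0//.
- exact: measurableI.
- exact: measurableI.
apply/eqP; rewrite eq_le measure_ge0 andbT -(square_null mu_permuton).
by apply: le_measure; rewrite ?inE//; exact: measurableI.
Qed.

Lemma xlawE (A : set mR) : measurable A -> xlaw A = leb (A `&` I).
Proof.
move=> mA; have mAI : measurable (A `&` I).
  by apply: measurableI => //; exact: measurable_unit_itv.
have [<- _] := mu_permuton mAI (@subIsetr _ _ _).
rewrite /xlaw /= /distribution /pushforward mu_square.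
  by congr (mu _); apply/seteqP; split => [p [? []]|p [[]]].
by rewrite -[X in measurable X]setTI; exact: measurable_fst.
Qed.

Lemma ylawE (A : set mR) : measurable A -> ylaw A = leb (A `&` I).
Proof.
move=> mA; have mAI : measurable (A `&` I).
  by apply: measurableI => //; exact: measurable_unit_itv.
have [_ <-] := mu_permuton mAI (@subIsetr _ _ _).
rewrite /ylaw /= /distribution /pushforward mu_square.
  by congr (mu _); apply/seteqP; split => [p [? []]|p [? []]].
by rewrite -[X in measurable X]setTI; exact: measurable_snd.
Qed.

(** Both marginals are Lebesgue measure on [0,1], so the two measures agree on boxes; uniformity
    thus becomes independence. *)
Lemma uniform_product (A : set T) : measurable A ->
  ((leb \x leb) (A `&` (I `*` I)) = (xlaw \x ylaw) A)%E.
Proof.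
move=> mA; have mI := @measurable_unit_itv R.
pose M : {measure set T -> \bar R} := mrestr (leb \x leb)%E (@measurable_square R).
rewrite -[LHS]/(M A); apply/esym.
apply: (product_measure_unique (m' := M)) mA => B C mB mC.
have BC : (B `*` C) `&` (I `*` I) = (B `&` I) `*` (C `&` I).
  by apply/seteqP; split => [p [[? ?] [? ?]]|p [[? ?] [? ?]]].
rewrite /M /= /mrestr BC product_measure1E; [|exact: measurableI..].
by rewrite (xlawE mB) (ylawE mC).
Qed.

Lemma uniform_iff_product : is_uniform mu <->
  forall A, measurable A -> mu A = (xlaw \x ylaw)%E A.
Proof.
by split=> muE A mA; rewrite muE// uniform_product.
Qed.

Lemma ex_product (F : T -> R) : bmeas F ->
  (forall A, measurable A -> mu A = (xlaw \x ylaw)%E A) ->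
  ex mu F = ex xlaw (fun x => ex ylaw (fun y => F (x, y))).
Proof.
move=> bF muE.
have bFx x : bmeas (fun y => F (x, y)).
  exact: (bmeas_comp bF (pair1_measurable x)).
have iF : (xlaw \x ylaw)%E.-integrable setT (EFin \o F) by exact: bmeas_integrable.
rewrite [LHS]/ex /Rintegral.
rewrite (eq_measure_integral (xlaw \x ylaw)%E) => [|A mA _]; last exact: muE.
rewrite -(integral12_prod_meas1 iF) [RHS]/ex /Rintegral; congr fine.
by apply: eq_integral => x _; rewrite -[LHS](EFin_ex ylaw (bFx x)).
Qed.

Lemma uniform_indep (f g : R -> R) : bmeas f -> bmeas g -> is_uniform mu ->
  ex mu (fun r => f (cx r) * g (cy r)) =
  ex mu (fun r => f (cx r)) * ex mu (fun r => g (cy r)).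
Proof.
move=> bf bg /uniform_iff_product muE.
have mclamp : measurable_fun setT (@clamp R).
  by apply: measurable_maxr => //; exact: measurable_minr.
have bfc : bmeas (fun x : mR => f (clamp x)) by exact: bmeas_comp.
have bgc : bmeas (fun x : mR => g (clamp x)) by exact: bmeas_comp.
have bfx : bmeas (fun r : T => f (cx r)).
  exact: (bmeas_comp bfc measurable_fst).
have bgy : bmeas (fun r : T => g (cy r)).
  exact: (bmeas_comp bgc measurable_snd).
rewrite !ex_product//; last exact: bmeasM.
rewrite /cx /cy /xcoord /ycoord /=.
transitivity (ex xlaw (fun x => f (clamp x) * ex ylaw (fun y => g (clamp y)))).
  by apply: eq_ex => x; rewrite exZl.
rewrite exZr//; congr (_ * _); last by rewrite ex_cst.
by apply: eq_ex => x; rewrite ex_cst.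
Qed.

(** Clamping [c] preserves its comparison with points of [0,1] other than [clamp c], where the left
    side would be 1/2. *)
Lemma sg_clamp c u : I u -> u != clamp c ->
  (1 + Num.sg (clamp c - u)) / 2 = (u < c)%R%:R.
Proof.
rewrite /unit_itv /= in_itv /= => /andP[u0 u1] uc.
have -> : (u < c) = (u < clamp c).
  apply/idP/idP; rewrite /clamp.
    by move=> ltuc; move: uc; rewrite /clamp lt_neqAle => -> /=;
      rewrite le_max le_min u1 (ltW ltuc) orbT.
  by rewrite lt_max lt_min => /orP[|/andP[]//]; rewrite ltNge u0.
have [cu|uc'] := leP (clamp c) u.
  rewrite ltr0_sg; first by rewrite subrr mul0r.
  by rewrite subr_lt0 lt_neqAle cu eq_sym uc.
by rewrite gtr0_sg ?subr_gt0//; have -> : true%:R = 1 :> R by []; field.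
Qed.

Lemma eq_ex_square (s t : seq R) (f g : T -> R) : bmeas f -> bmeas g ->
  (forall r, (I `*` I) r -> xcoord r \notin s -> ycoord r \notin t -> f r = g r) ->
  ex mu f = ex mu g.
Proof.
move=> bf bg fg.
have [mx nx] := fibers_null (uniform_cx mu_permuton) s.
have [my ny] := fibers_null (uniform_cy mu_permuton) t.
have mIC := @measurable_squareC R; have nI := square_null mu_permuton.
apply: (@eq_ex_null _ _ _ _ (~` (I `*` I) `|`
  ([set p | cx p \in s] `|` [set p | cy p \in t]))) => //.
- by apply: measurableU => //; exact: measurableU.
- by rewrite measureU0//; [exact: measurableU|rewrite [LHS]measureU0].
move=> r /not_orP[/contrapT Ir] /not_orP[/negP rx /negP ry].
have [Ix Iy] := Ir.
by apply: fg => //; [move: rx; rewrite /cx clamp_id|move: ry; rewrite /cy clamp_id].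
Qed.

Lemma mu_eq_ex (a b : R) (A : set T) f : measurable A -> bmeas f ->
  (forall r, (I `*` I) r -> xcoord r != clamp a -> ycoord r != clamp b ->
    \1_A r = f r) -> mu A = (ex mu f)%:E.
Proof.
move=> mA bf Af; rewrite -[LHS]fineK ?fin_num_measure// -ex_indic//.
congr (_ %:E); apply: (eq_ex_square (s := [:: clamp a]) (t := [:: clamp b])) => //.
  exact: bmeas_ind.
by move=> r Ir; rewrite !inE; exact: Af.
Qed.

(** Almost surely the indicators of the rays are [fa] and [fb], affine in the signs, so
    [ex_sg_sg_indep] gives the factorisation. *)
Lemma quadrant_indep a b : gap_prod mu cx cy = 0 ->
  mu (ray a `*` ray b) = (xlaw (ray a) * ylaw (ray b))%E.
Proof.
move=> J0; have uX := uniform_cx mu_permuton; have uY := uniform_cy mu_permuton.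
have bX := bmeas_coord uX; have bY := bmeas_coord uY.
have mray c : measurable (ray c) by exact: measurable_itv.
have [ca cb] : 0 <= clamp a <= 1 /\ 0 <= clamp b <= 1 by split; exact: clamp_itv.
pose fa r := (1 + Num.sg (clamp a - cx r)) / 2.
pose fb r := (1 + Num.sg (clamp b - cy r)) / 2.
have bfa : bmeas fa by rewrite /fa; bm.
have bfb : bmeas fb by rewrite /fb; bm.
have xE : xlaw (ray a) = (ex mu fa)%:E.
  apply: (@mu_eq_ex a b) => //.
    by rewrite -[X in measurable X]setTI; exact: measurable_fst.
  move=> r [Ix _] xa _; rewrite /fa /cx (clamp_id (u := xcoord r))// sg_clamp// indicE.
  by congr (nat_of_bool _)%:R; apply/idP/idP; rewrite inE /= in_itv.
have yE : ylaw (ray b) = (ex mu fb)%:E.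
  apply: (@mu_eq_ex a b) => //.
    by rewrite -[X in measurable X]setTI; exact: measurable_snd.
  move=> r [_ Iy] _ yb; rewrite /fb /cy (clamp_id (u := ycoord r))// sg_clamp// indicE.
  by congr (nat_of_bool _)%:R; apply/idP/idP; rewrite inE /= in_itv.
have muE : mu (ray a `*` ray b) = (ex mu (fun r => fa r * fb r))%:E.
  apply: (@mu_eq_ex a b); [exact: measurableX|exact: bmeasM|].
  move=> r [Ix Iy] xa yb; rewrite /fa /fb /cx /cy (clamp_id (u := xcoord r))//
    (clamp_id (u := ycoord r))// !sg_clamp//.
  rewrite -natrM mulnb indicE; congr (nat_of_bool _)%:R.
  by apply/idP/andP; rewrite inE /= !in_itv.
have faE : ex mu fa = clamp a.
  by rewrite /fa exZr ?exD ?ex_cst ?(uc_sg uX)//; try (by bm); field.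
have fbE : ex mu fb = clamp b.
  by rewrite /fb exZr ?exD ?ex_cst ?(uc_sg uY)//; try (by bm); field.
rewrite muE xE yE faE fbE -EFinM; congr (_ %:E).
transitivity (ex mu (fun r => 1 / 4 + (1 / 4) * Num.sg (clamp a - cx r) +
  (1 / 4) * Num.sg (clamp b - cy r) +
  (1 / 4) * (Num.sg (clamp a - cx r) * Num.sg (clamp b - cy r)))).
  by apply: eq_ex => r; rewrite /fa /fb; field.
rewrite !exD; try by bm.
rewrite !exZl; try by bm.
rewrite ex_cst (uc_sg uX)// (uc_sg uY)// (ex_sg_sg_indep uX uY J0)//.
by field.
Qed.

Lemma gap_prod0_uniform : gap_prod mu cx cy = 0 -> is_uniform mu.
Proof.
move=> J0; apply/uniform_iff_product => A mA.
apply/esym; apply: (product_measure_unique (m' := mu)) mA => B C mB mC.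
rewrite -product_measure1E//; apply: eq_measure_quadrants => //.
  by rewrite ltey_eq fin_num_measure.
move=> a b; apply: etrans (quadrant_indep a b J0) _.
by apply/esym; apply: product_measure1E; exact: measurable_itv.
Qed.

End marginals.

(** * Means of the concordance polynomials *)

Section concordance_moments.
Context {d : measure_display} {T : measurableType d} {R : realType}.
Variables (P : probability T R) (K : T -> T -> R).
Hypotheses (bK : bmeas (fun w : T * T => K w.1 w.2)).
Local Notation E4 := (ex4 P).

(** Renaming the sample points preserves [E4], so one mean serves for each family: cherries here,
    then matchings and 4-cycles. *)
Let c := E4 (fun p q r s => K p q * K p r).

Ltac bm4 := rewrite /bmeas4 /cherries /cycle4; by bm.

Let cherry2 : E4 (fun p q r s => K p q * K p s) = c.
Proof. by apply/esym; apply: ex4_swap34; bm4. Qed.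

Let cherry3 : E4 (fun p q r s => K p r * K p s) = c.
Proof. by apply: etrans _ cherry2; apply/esym; apply: ex4_swap23; bm4. Qed.

Let cherries1 : E4 (cherries K) = 3 * c.
Proof.
rewrite /cherries !ex4D; try bm4.
by rewrite cherry2 cherry3 -/c; clear; move: c => x; ring.
Qed.

Let cherries2 : E4 (fun p q r s => cherries K q p r s) = 3 * c.
Proof. by apply: etrans _ cherries1; apply/esym; apply: ex4_swap12; bm4. Qed.

Let cherries3 : E4 (fun p q r s => cherries K r p q s) = 3 * c.
Proof. by apply: etrans _ cherries2; apply/esym; apply: ex4_swap23; bm4. Qed.

Let cherries4 : E4 (fun p q r s => cherries K s p q r) = 3 * c.
Proof. by apply: etrans _ cherries3; apply/esym; apply: ex4_swap34; bm4. Qed.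

Let cherry12 : E4 (fun p q r s => K q p * K q r) = c.
Proof. by apply/esym; apply: ex4_swap12; bm4. Qed.

Let cherry13 : E4 (fun p q r s => K r p * K r q) = c.
Proof. by apply: etrans _ cherry12; apply/esym; apply: ex4_swap23; bm4. Qed.

Let m := E4 (fun p q r s => K p q * K r s).

Let matching2 : E4 (fun p q r s => K p r * K q s) = m.
Proof. by apply/esym; apply: ex4_swap23; bm4. Qed.

Let matching3 : E4 (fun p q r s => K p s * K q r) = m.
Proof. by apply: etrans _ matching2; apply/esym; apply: ex4_swap34; bm4. Qed.

Let y := E4 (cycle4 K).

Let cycle2 : E4 (fun p q r s => cycle4 K p r q s) = y.
Proof. by apply/esym; apply: ex4_swap23; bm4. Qed.

Let cycle3 : E4 (fun p q r s => cycle4 K p s q r) = y.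
Proof. by apply: etrans _ cycle2; apply/esym; apply: ex4_swap34; bm4. Qed.

Let mE : m = ex2 P K ^+ 2.
Proof.
rewrite /m /ex4 expr2.
transitivity (ex2 P (fun p q => ex2 P K * K p q)).
  by apply: eq_ex2 => p q; rewrite (ex2Z P _ bK) mulrC.
exact: (ex2Z P _ bK).
Qed.

Let yE : y = ex2 P (fun p q => ex P (fun r => K p r * K r q) ^+ 2).
Proof.
apply: eq_ex2 => p q; rewrite expr2 -ex2_prod; [|by bm..].
by apply: eq_ex2 => r s.
Qed.

(** The cherries cancel, with total coefficient [3 / 4] in [monotone3] and [- 12 / 16] in [graph4].
    There remain [1 / 4 + 3 / 16], three equal matchings and three equal 4-cycles. *)
Lemma ex4_patterns : E4 (fun p q r s => monotone3 K p q r + graph4 K p q r s) =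
  7 / 16 + 3 / 8 * ex2 P K ^+ 2 +
  3 / 16 * ex2 P (fun p q => ex P (fun r => K p r * K r q) ^+ 2).
Proof.
have lin (a b e : R) : 7 / 16 + 1 / 4 * a + 1 / 4 * a + 1 / 4 * a + 1 / 8 * b +
    1 / 8 * b + 1 / 8 * b + 1 / 16 * e + 1 / 16 * e + 1 / 16 * e +
    - (1 / 16) * (3 * a) + - (1 / 16) * (3 * a) + - (1 / 16) * (3 * a) +
    - (1 / 16) * (3 * a) = 7 / 16 + 3 / 8 * b + 3 / 16 * e by field.
transitivity (E4 (fun p q r s => 7 / 16 + 1 / 4 * (K p q * K p r) +
  1 / 4 * (K q p * K q r) + 1 / 4 * (K r p * K r q) + 1 / 8 * (K p q * K r s) +
  1 / 8 * (K p r * K q s) + 1 / 8 * (K p s * K q r) +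
  1 / 16 * cycle4 K p q r s + 1 / 16 * cycle4 K p r q s + 1 / 16 * cycle4 K p s q r +
  (- (1 / 16)) * cherries K p q r s + (- (1 / 16)) * cherries K q p r s +
  (- (1 / 16)) * cherries K r p q s + (- (1 / 16)) * cherries K s p q r)).
  by apply: eq_ex4 => p q r s; rewrite /monotone3 /graph4; field.
rewrite !ex4D; try bm4.
rewrite !ex4Z; try bm4.
rewrite ex4_cst cherry12 cherry13 matching2 matching3 cycle2 cycle3 cherries1
  cherries2 cherries3 cherries4 -/c -/m -/y -mE -yE.
exact: lin.
Qed.

End concordance_moments.

(** * The density of [rho_star] through concordances *)

Section density_formula.
Context {R : realType}.
Local Notation T := (plane R).
Local Notation I := (@unit_itv R).
Variable mu : probability T R.
Local Notation E := (ex mu).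

Let mcons n (A : set (n.+1.-tuple T)) p : measurable A ->
  measurable [set t | A (tuple_cons (p, t))].
Proof.
move=> mA; rewrite -[X in measurable X]setTI.
by apply: (measurableT_comp (@measurable_tuple_cons _ T n) (pair1_measurable p)).
Qed.

(** A dummy fourth point puts the patterns of order 3 under the same [ex4] as those of order 4. *)
Lemma density3E w (wP : perm_eq w (iota 1 3)) :
  density (perm_of_word wP) mu = ex4 mu (fun p q r _ => occurs3 wP p q r).
Proof.
have mA := measurable_pattern_event (R := R) (perm_of_word wP).
rewrite /density (power_measureS mu mA); apply: eq_ex => p.
rewrite (power_measureS mu (mcons p mA)).
apply: eq_ex => q; rewrite (power_measureS mu (mcons q (mcons p mA))).
by apply: eq_ex => r; rewrite ex_cst.
Qed.

Lemma density4E w (wP : perm_eq w (iota 1 4)) :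
  density (perm_of_word wP) mu = ex4 mu (occurs4 wP).
Proof.
have mA := measurable_pattern_event (R := R) (perm_of_word wP).
rewrite /density (power_measureS mu mA); apply: eq_ex => p.
rewrite (power_measureS mu (mcons p mA)).
apply: eq_ex => q; rewrite (power_measureS mu (mcons q (mcons p mA))).
apply: eq_ex => r; rewrite (power_measureS mu (mcons r (mcons q (mcons p mA)))).
exact: eq_ex.
Qed.

Lemma measurable_fun_tuple_cons d (Z : measurableType d) n (f : Z -> T)
    (g : Z -> n.-tuple T) : measurable_fun setT f -> measurable_fun setT g ->
  measurable_fun setT (fun z => tuple_cons (f z, g z)).
Proof. by move=> mf mg; exact: measurable_cons. Qed.

Lemma bmeas_occurs3 w (wP : perm_eq w (iota 1 3)) :
  bmeas4 (fun p q r (_ : T) => occurs3 wP p q r).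
Proof.
have mA := measurable_pattern_event (R := R) (perm_of_word wP).
apply: (bmeas_comp (bmeas_ind mA)).
by do 3 (apply: measurable_fun_tuple_cons; first by measurable_proj).
Qed.

Lemma bmeas_occurs4 w (wP : perm_eq w (iota 1 4)) : bmeas4 (occurs4 (R := R) wP).
Proof.
have mA := measurable_pattern_event (R := R) (perm_of_word wP).
apply: (bmeas_comp (bmeas_ind mA)).
by do 4 (apply: measurable_fun_tuple_cons; first by measurable_proj).
Qed.

Let ex4_sum6 (F1 F2 F3 F4 F5 F6 : T -> T -> T -> T -> R) : bmeas4 F1 ->
  bmeas4 F2 -> bmeas4 F3 -> bmeas4 F4 -> bmeas4 F5 -> bmeas4 F6 ->
  1 * ex4 mu F1 + (1 * ex4 mu F2 + (1 * ex4 mu F3 + (1 * ex4 mu F4 +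
    (1 / 2 * ex4 mu F5 + (1 / 2 * ex4 mu F6 + 0))))) =
  ex4 mu (fun p q r s => F1 p q r s + (F2 p q r s + (F3 p q r s + (F4 p q r s +
    (1 / 2 * F5 p q r s + 1 / 2 * F6 p q r s))))).
Proof.
have norm (a b c d e f : R) :
    1 * a + (1 * b + (1 * c + (1 * d + (1 / 2 * e + (1 / 2 * f + 0))))) =
    a + (b + (c + (d + (1 / 2 * e + 1 / 2 * f)))) by ring.
move=> b1 b2 b3 b4 b5 b6.
have h5 := bmeas4Z (1 / 2) b5; have h6 := bmeas4Z (1 / 2) b6.
have h56 := bmeas4D h5 h6; have h46 := bmeas4D b4 h56.
have h36 := bmeas4D b3 h46; have h26 := bmeas4D b2 h36.
rewrite (ex4D mu b1 h26) (ex4D mu b2 h36) (ex4D mu b3 h46) (ex4D mu b4 h56).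
by rewrite (ex4D mu h5 h6) (ex4Z mu _ b5) (ex4Z mu _ b6); exact: norm.
Qed.

Hypothesis mu_permuton : is_permuton mu.

(** The points are drawn in turn, and each avoids, up to a null set, the finitely many vertical and
    horizontal lines through the earlier ones. *)
Lemma eq_ex4_generic (F G : T -> T -> T -> T -> R) : bmeas4 F -> bmeas4 G ->
  (forall p q r s, (I `*` I) p -> (I `*` I) q -> (I `*` I) r -> (I `*` I) s ->
     generic [:: p; q; r; s] -> F p q r s = G p q r s) -> ex4 mu F = ex4 mu G.
Proof.
move=> bF bG FG.
have b1 H : bmeas4 H -> bmeas (fun p : T => E (fun q => E (fun r => E (H p q r)))).
  by move=> bH; do 3 apply: bmeas_ex; apply: (bmeas4_comp bH); measurable_proj.
have b2 H p : bmeas4 H -> bmeas (fun q : T => E (fun r => E (H p q r))).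
  by move=> bH; do 2 apply: bmeas_ex; apply: (bmeas4_comp bH); measurable_proj.
have b3 H p q : bmeas4 H -> bmeas (fun r : T => E (H p q r)).
  by move=> bH; apply: bmeas_ex; apply: (bmeas4_comp bH); measurable_proj.
have b4 H p q r : bmeas4 H -> bmeas (H p q r).
  by move=> bH; apply: (bmeas4_comp bH); measurable_proj.
apply: (eq_ex_square mu_permuton (s := [::]) (t := [::])); [exact: b1|exact: b1|].
move=> p Ip _ _.
apply: (eq_ex_square mu_permuton (s := [:: xcoord p]) (t := [:: ycoord p]));
  [exact: b2|exact: b2|].
move=> q Iq; rewrite !inE => xq yq.
apply: (eq_ex_square mu_permuton (s := [:: xcoord p; xcoord q])
  (t := [:: ycoord p; ycoord q])); [exact: b3|exact: b3|].
move=> r Ir; rewrite !inE !negb_or => /andP[xpr xqr] /andP[ypr yqr].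
apply: (eq_ex_square mu_permuton (s := [:: xcoord p; xcoord q; xcoord r])
  (t := [:: ycoord p; ycoord q; ycoord r])); [exact: b4|exact: b4|].
move=> s Is; rewrite !inE !negb_or => /and3P[xps xqs xrs] /and3P[yps yqs yrs].
apply: FG => //; rewrite /generic /= !inE !negb_or.
rewrite ![xcoord p == _]eq_sym ![ycoord p == _]eq_sym.
rewrite (eq_sym (xcoord q) (xcoord r)) (eq_sym (ycoord q) (ycoord r)).
rewrite (eq_sym (xcoord q) (xcoord s)) (eq_sym (ycoord q) (ycoord s)).
rewrite (eq_sym (xcoord r) (xcoord s)) (eq_sym (ycoord r) (ycoord s)).
by rewrite xq yq xpr xqr ypr yqr xps xqs xrs yps yqs yrs.
Qed.

Local Notation K := (concord (@cx R) (@cy R)).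

Lemma concordance_clamp p q : (I `*` I) p -> (I `*` I) q -> concordance p q = K p q.
Proof. by move=> [? ?] [? ?]; rewrite /concordance /concord /cx /cy !clamp_id. Qed.

Lemma lin_density_rho_star : lin_density (rho_star R) mu =
  7 / 16 + 3 / 8 * ex2 mu K ^+ 2 +
  3 / 16 * ex2 mu (fun p q => codegree mu (@cx R) (@cy R) p q ^+ 2).
Proof.
have bK := bmeas_concord (uniform_cx mu_permuton) (uniform_cy mu_permuton).
rewrite -(ex4_patterns mu bK).
have -> : lin_density (rho_star R) mu =
  1 * density (perm_of_word w123) mu + (1 * density (perm_of_word w321) mu +
  (1 * density (perm_of_word w2143) mu + (1 * density (perm_of_word w3412) mu +
  (1 / 2 * density (perm_of_word w2413) mu +
  (1 / 2 * density (perm_of_word w3142) mu + 0))))).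
  by rewrite /lin_density /rho_star !big_cons big_nil.
rewrite !density3E !density4E.
have b1 := bmeas_occurs3 w123; have b2 := bmeas_occurs3 w321.
have b3 := bmeas_occurs4 w2143; have b4 := bmeas_occurs4 w3412.
have b5 := bmeas_occurs4 w2413; have b6 := bmeas_occurs4 w3142.
rewrite (ex4_sum6 b1 b2 b3 b4 b5 b6); apply: eq_ex4_generic.
- do 3 (apply: bmeas4D => //); apply: bmeas4D => //.
  by apply: bmeas4D; exact: bmeas4Z.
- by rewrite /bmeas4 /monotone3 /graph4 /cycle4 /cherries; bm.
move=> p q r s Ip Iq Ir Is gen.
have gen3 : generic [:: p; q; r].
  move: gen; rewrite /generic /= !inE !negb_or.
  case/andP=> /and4P[/and3P[-> -> _] /andP[-> _] _ _].
  by case/and4P=> [/and3P[-> -> _] /andP[-> _] _ _].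
have kE := concordance_clamp.
have <- : monotone3 (@concordance R) p q r = monotone3 K p q r.
  by rewrite /monotone3 !kE.
have <- : graph4 (@concordance R) p q r s = graph4 K p q r s.
  by rewrite /graph4 /cycle4 /cherries !kE.
rewrite -(occurs3_monotone gen3) -(occurs4_graph gen).
by field.
Qed.

End density_formula.

Theorem theorem3p1 (R : realType) (mu : probability (plane R) R)
    (mu_permuton : is_permuton mu) :
  11 / 24 <= lin_density (rho_star R) mu /\
  (lin_density (rho_star R) mu = 11 / 24 <-> is_uniform mu).
Proof.
(* The value 11/24 is [7 / 16 + 3 / 16 * (1 / 9)], reached at [t = 0] and [k = 1 / 9]; the positive
   coefficient of [j] then forces [j = 0]. *)
have lin (t k j s : R) : 1 / 9 + 96 * j + 32 * s <= k -> 0 <= j -> 0 <= s ->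
    let f := 7 / 16 + 3 / 8 * t ^+ 2 + 3 / 16 * k in
    11 / 24 <= f /\ (f = 11 / 24 -> j = 0).
  by move=> kj j0 s0; have := sqr_ge0 t; split; lra.
have uX := uniform_cx mu_permuton; have uY := uniform_cy mu_permuton.
have J0 : 0 <= gap_prod mu (@cx R) (@cy R).
  by apply: ex_ge0 => p; apply: ex_ge0 => q; exact: sqr_ge0.
have S0 : 0 <= gap_diag mu (@cx R) (@cy R).
  by apply: ex_ge0 => p; exact: sqr_ge0.
have := lin (ex2 mu (concord (@cx R) (@cy R))) _ _ _ (codegree_sqr_ge uX uY) J0 S0.
rewrite (lin_density_rho_star mu_permuton) => -[ge eq0]; split=> //.
split=> [/eq0|unif]; first exact: gap_prod0_uniform.
have indep f g (bf : bmeas f) (bg : bmeas g) :=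
  uniform_indep mu_permuton bf bg unif.
rewrite (ex2_concord_indep uX uY indep) (ex2_codegree_indep uX uY indep).
by clear; field.
Qed.
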